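(* Let $G$ be a finite simple graph. Then the following conditions are equivalent: (i) $\mathcal{Q}_G$ is unimodular; (ii) $\overline{G}$ is bipartite. Moreover, if $\alpha(G)=2$, then the conditions (iii) $\mathcal{Q}_G$ is compressed; (iv) $G$ is perfect are also equivalent to conditions (i) and (ii).
   Context: $G$ is a graph on $[n]=\{1,\dots,n\}$; $\overline{G}$ is its complement. A subset $W\subset[n]$ is stable if no two distinct elements of $W$ form an edge of $G$ (the empty set and singletons are stable); $\alpha(G)$ is the largest cardinality of a stable set. With $\rho(W)=\sum_{j\in W}\mathbf{e}_j$, the stable set polytope $\mathcal{Q}_G\subset\mathbb{R}^n$ is the convex hull of the $\rho(W)$ for $W$ stable in $G$. A graph is perfect if for every induced subgraph the chromatic number equals the size of its largest clique. Let $K$ be a field. For an integral convex polytope $\mathcal{P}\subset\mathbb{R}^n$ with $\mathcal{P}\cap\mathbb{Z}^n=\{\mathbf{a}_1,\dots,\mathbf{a}_m\}$, the toric ideal $I_{\mathcal{P}}$ is the kernel of the $K$-algebra homomorphism $K[y_1,\dots,y_m]\to K[x_1^{\pm1},\dots,x_n^{\pm1},t]$, $y_i\mapsto X^{\mathbf{a}_i}t$ (where $X^{\mathbf{a}}=x_1^{a_1}\cdots x_n^{a_n}$). $\mathcal{P}$ is unimodular if any triangulation of $\mathcal{P}$ (with vertices in $\mathcal{P}\cap\mathbb{Z}^n$) is unimodular; equivalently, the initial ideal of $I_{\mathcal{P}}$ is generated by squarefree monomials with respect to any monomial order. $\mathcal{P}$ is compressed if any pulling triangulation of $\mathcal{P}$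 is unimodular; equivalently, the initial ideal of $I_{\mathcal{P}}$ is generated by squarefree monomials with respect to any reverse lexicographic order. *)

(* Defs.v *)
From HB Require Import structures.
From mathcomp Require Import all_boot all_order all_algebra finmap.
From mathcomp Require Import all_classical all_reals.

Set Implicit Arguments.
Unset Strict Implicit.
Unset Printing Implicit Defensive.

Import Order.TTheory GRing.Theory Num.Theory.

(* A simple graph on a finite type T is its adjacency relation e : rel T,
   assumed symmetric and irreflexive in the theorem. *)
Section Graphs.
Variables (T : finType) (e : rel T).

Definition stable (W : {set T}) : bool :=
  [forall x in W, forall y in W, (x != y) ==> ~~ e x y].

Definition clique (W : {set T}) : bool :=
  [forall x in W, forall y in W, (x != y) ==> e x y].

Definition stability_number : nat := \max_(W : {set T} | stable W) #|W|.

Definition clique_number : nat := \max_(W : {set T} | clique W) #|W|.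

Definition complement_graph : rel T := [rel x y | (x != y) && ~~ e x y].

Definition bipartite : Prop :=
  exists f : T -> bool, forall x y, e x y -> f x != f y.

Definition proper_coloring (f : {ffun T -> T}) : bool :=
  [forall x, forall y, e x y ==> (f x != f y)].

(* #|T| colors always suffice, so colors are taken in T itself and the colors
   actually used are counted; the default value #|T| of the minimum is attained
   by the identity coloring. *)
Definition chromatic_number : nat :=
  \big[minn/#|T|]_(f : {ffun T -> T} | proper_coloring f) #|codom f|.

Definition induced_graph (S : {set T}) : rel {x : T | x \in S} :=
  [rel x y | e (val x) (val y)].

End Graphs.

Definition perfect (T : finType) (e : rel T) : Prop :=
  forall S : {set T},
    chromatic_number (induced_graph e (S := S)) =
    clique_number (induced_graph e (S := S)).

Local Open Scope classical_set_scope.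
Local Open Scope ring_scope.

Section Polytopes.
Variables (R : realType) (n : nat).
Implicit Types (P F : set 'rV[R]_n) (s t : {fset 'rV[R]_n}).
Implicit Types (D : set {fset 'rV[R]_n}) (a : seq 'rV[R]_n).

Definition convex_hull (A : set 'rV[R]_n) : set 'rV[R]_n :=
  [set x | exists (k : nat) (p : 'I_k -> 'rV[R]_n) (w : 'I_k -> R),
     [/\ forall i, A (p i), forall i, 0 <= w i,
         \sum_i w i = 1 & x = \sum_i w i *: p i]].

Definition lattice_points P : set 'rV[R]_n :=
  P `&` [set x | forall j, x 0 j \is a Num.int].

Definition affinely_independent s : Prop :=
  forall w : 'rV[R]_n -> R,
    \sum_(v <- s) w v = 0 -> \sum_(v <- s) w v *: v = 0 ->
    forall v, v \in s -> w v = 0.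

(* A simplex is given by its vertex set; the empty simplex is allowed. *)
Definition triangulation P D : Prop :=
  [/\ finite_set D,
      forall s, D s -> affinely_independent s /\ [set` s] `<=` lattice_points P,
      forall s t, D s -> (t `<=` s)%fset -> D t,
      forall s t, D s -> D t ->
        convex_hull [set` s] `&` convex_hull [set` t] =
        convex_hull [set` (s `&` t)%fset] &
      \bigcup_(s in D) convex_hull [set` s] = P].

(* The vertices of s form an affine basis of the affine lattice generated by
   the lattice points of P, i.e. s has normalized volume 1 with respect to it.
   This is the lattice relevant to the toric ideal of P; for stable set
   polytopes, which contain 0 and the unit vectors, it is Z^n. *)
Definition unimodular_simplex P s : Prop :=
  [/\ affinely_independent s,
      [set` s] `<=` lattice_points P &
      forall x, lattice_points P x ->
        exists w : 'rV[R]_n -> int,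
          \sum_(v <- s) w v = 1 /\ x = \sum_(v <- s) v *~ w v].

Definition maximal_simplex D s : Prop :=
  D s /\ forall t, D t -> (s `<=` t)%fset -> t = s.

Definition unimodular_complex P D : Prop :=
  forall s, maximal_simplex D s -> unimodular_simplex P s.

Definition unimodular_polytope P : Prop :=
  forall D, triangulation P D -> unimodular_complex P D.

(* The empty set and P itself are faces. *)
Definition face P F : Prop :=
  exists (c : 'rV[R]_n) (b : R),
    (forall x, P x -> \sum_j c 0 j * x 0 j <= b) /\
    F = P `&` [set x | \sum_j c 0 j * x 0 j = b].

Definition facet P F : Prop :=
  [/\ face P F, F <> P &
      forall F', face P F' -> F `<=` F' -> F' = F \/ F' = P].

(* Maximal simplices of the pulling triangulation for the order in which a
   enumerates the lattice points: cone from the first lattice point v of P over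
   the pulling triangulations of the facets of P not containing v.  The empty
   set is the only facet of a point, so the recursion starts from it. *)
Inductive pulling_cell a : set 'rV[R]_n -> {fset 'rV[R]_n} -> Prop :=
| pulling_cell0 : pulling_cell a set0 fset0
| pulling_cell_cone P F v s :
    ohead [seq u <- a | u \in P] = Some v ->
    facet P F -> ~ F v -> pulling_cell a F s ->
    pulling_cell a P (v |` s)%fset.

Definition pulling_triangulation a P : set {fset 'rV[R]_n} :=
  [set t | exists2 s, pulling_cell a P s & (t `<=` s)%fset].

Definition compressed_polytope P : Prop :=
  forall a, uniq a -> [set` a] = lattice_points P ->
    unimodular_complex P (pulling_triangulation a P).

Definition indicator_vector (W : {set 'I_n}) : 'rV[R]_n :=
  \row_j (j \in W)%:R.

Definition stable_set_polytope (e : rel 'I_n) : set 'rV[R]_n :=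
  convex_hull [set indicator_vector W | W in [set W | stable e W]].

End Polytopes.

Arguments stable_set_polytope R {n} e.

(* Main.v *)
(* Write H for the complement of G, so that the stable sets of G are the cliques of H.

   If H is bipartite, a maximal simplex s of a triangulation (or a cell of a pulling
   triangulation) spans the polytope affinely, and every affine functional that is
   integral on s is integral on all lattice points; applied to the functionals dual
   to s this shows that s is unimodular.

   If H is not bipartite, take a minimal nonbipartite set F of edges of H, with
   vertex set S. A weighting of the vertices that sums to 0 on each edge of F
   vanishes on S, and the 2-colourings of F minus one edge show that F is independent.
   Hence the origin, the unit vectors outside S and the edges of F span a simplex of
   full dimension on whose vertices the coordinate sum over S is even, so that it is
   not unimodular. It belongs to a triangulation, namely the one formed by the
   supports of the lexicographically smallest convex representations of the points of
   the polytope. If alpha(G) = 2, the sum over S is at most 2, and pulling first the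
   unit vectors outside S and then the origin leads to the facet where it equals 2,
   whence again a cell with even coordinate sums.

   If H is bipartite then G is perfect by Koenig's theorem. If alpha(G) = 2 and G is
   perfect, the subgraph induced by S needs at least |S|/2 colours, while
   every independent set I of H in S satisfies 2|I| < |F| <= |S| because all degrees
   in F are at least 2. *)
From HB Require Import structures.
Require Import Defs.
From mathcomp Require Import all_boot all_order all_algebra finmap.
From mathcomp Require Import ring lra zify.

Set Implicit Arguments.
Unset Strict Implicit.
Unset Printing Implicit Defensive.

Import Order.TTheory GRing.Theory Num.Theory.

(** * Colourings, circuits and perfect graphs *)

Section Koenig.
Variables (T U : finType).
Implicit Types (E F : {set T * U}) (X : {set T}).

Definition neighbours E X : {set U} := [set y | [exists x in X, (x, y) \in E]].

Lemma neighboursP E X y :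
  reflect (exists2 x, x \in X & (x, y) \in E) (y \in neighbours E X).
Proof. by rewrite inE; apply: (iffP exists_inP). Qed.

(* Rado's argument: in an edge set minimal for the bound k, two edges (a, b1) and
   (a, b2) would give two violators of the bound after deleting one edge each,
   and submodularity makes one of X1 :|: X2, (X1 :&: X2) :\ a a violator
   for the whole edge set. *)
Lemma rado_selection E k :
  (forall X, k <= #|~: X| + #|neighbours E X|) ->
  exists F : {set T * U}, [/\ F \subset E, k <= #|neighbours F setT| &
    forall a b b', (a, b) \in F -> (a, b') \in F -> b = b'].
Proof.
move=> kE; pose P F := [forall X, k <= #|~: X| + #|neighbours F X|].
have [F /minsetP[/forallP kF minF] FE] : {F | minset P F & F \subset E}.
  by apply: minset_exists; apply/forallP.
exists F; split=> //; first by have := kF setT; rewrite setCT cards0.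
move=> a b1 b2 ab1 ab2; apply/eqP/negPn/negP => b12.
have violator b : (a, b) \in F -> exists2 X : {set T}, a \in X &
    #|~: X| + #|neighbours (F :\ (a, b)) X| < k.
  move=> ab; have : ~~ P (F :\ (a, b)).
    apply/negP => /minF /(_ (subD1set _ _)) FD.
    by move: ab; rewrite -FD setD11.
  rewrite negb_forall => /existsP[X]; rewrite -ltnNge => ltX; exists X => //.
  apply: contraTT ltX => aX; rewrite -leqNgt (leq_trans (kF X)) // leq_add2l.
  apply/subset_leq_card/subsetP => y /neighboursP[x xX xyF].
  apply/neighboursP; exists x => //; rewrite !inE xyF andbT xpair_eqE negb_and.
  by case: eqVneq aX => // <-; rewrite xX.
have [X1 aX1 lt1] := violator _ ab1; have [X2 aX2 lt2] := violator _ ab2.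
set N1 := neighbours _ X1 in lt1; set N2 := neighbours _ X2 in lt2.
(* The deleted edge [(a, b1)] is lost only for [X1]: it still counts for [X2], because [b1] and [b2]
   differ. The same holds with the roles exchanged. *)
have NU : neighbours F (X1 :|: X2) \subset N1 :|: N2.
  apply/subsetP => y /neighboursP[x]; rewrite !in_setU => xX xyF.
  have [xy1|xy1] := eqVneq (x, y) (a, b1).
    case: xy1 => _ ->; apply/orP; right; apply/neighboursP; exists a => //.
    by rewrite !inE ab1 andbT xpair_eqE eqxx.
  have [xy2|xy2] := eqVneq (x, y) (a, b2).
    case: xy2 => _ ->; apply/orP; left; apply/neighboursP; exists a => //.
    by rewrite !inE ab2 andbT xpair_eqE eqxx eq_sym.
  case/orP: xX => xX; apply/orP; [left|right]; apply/neighboursP.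
    by exists x => //; rewrite !inE xy1.
  by exists x => //; rewrite !inE xy2.
have NI : neighbours F ((X1 :&: X2) :\ a) \subset N1 :&: N2.
  apply/subsetP => y /neighboursP[x]; rewrite !inE => /and3P[xa x1 x2] xyF.
  apply/andP; split; apply/exists_inP; exists x => //;
  by rewrite !inE xyF andbT xpair_eqE (negPf xa).
(* Leaving out [a] costs one unit, while the two strict violations together gain two. *)
have CD : #|~: ((X1 :&: X2) :\ a)| = #|~: X1 :|: ~: X2|.+1.
  rewrite setCD setCI setUC cardsU1.
  by rewrite !inE aX1 aX2.
have := leq_add (kF (X1 :|: X2)) (kF ((X1 :&: X2) :\ a)).
have := subset_leq_card NU; have := subset_leq_card NI.
have := cardsUI N1 N2; have := cardsUI (~: X1) (~: X2).
rewrite CD setCU; move: lt1 lt2; lia.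
Qed.

End Koenig.

(** * Colourings of graphs with bipartite complement *)

Section PerfectGraphs.
Variable T : finType.
Implicit Types (g : rel T) (f : {ffun T -> T}).

(** The minimum also ranges over its default value [#|T|], so a bound has to be checked there
    too. *)
Lemma chromatic_number_ind (K : nat -> Prop) g : K #|T| ->
  (forall i j, K i -> K j -> K (minn i j)) ->
  (forall f, proper_coloring g f -> K #|codom f|) -> K (chromatic_number g).
Proof. by move=> K0 Kmin Kf; apply: (big_ind K). Qed.

Lemma chromatic_number_le g f :
  proper_coloring g f -> chromatic_number g <= #|codom f|.
Proof.
rewrite /chromatic_number => gf.
rewrite -[X in X <= _]big_filter.
have : f \in [seq i <- index_enum {ffun T -> T} | proper_coloring g i].
  by rewrite mem_filter gf mem_index_enum.
elim: [seq _ <- _ | _] => // h s IHs; rewrite in_cons big_cons => /orP[/eqP <-|fs].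
  exact: geq_minl.
by rewrite (leq_trans (geq_minr _ _)) // IHs.
Qed.

Lemma clique_chromatic_le g : clique_number g <= chromatic_number g.
Proof.
apply/bigmax_leqP => W /forall_inP cW.
apply: (chromatic_number_ind (K := fun k => #|W| <= k)) => [|i j|f /forallP gf];
  first exact: max_card.
- by rewrite leq_min => -> ->.
- rewrite -(@card_in_image _ _ f W).
    by apply/subset_leq_card/subsetP => _ /imageP[x _ ->]; apply: codom_f.
  move=> x y xW yW fxy; apply/eqP/negPn/negP => xy.
  have /forallP/(_ y) := gf x; rewrite fxy eqxx /= implybF => /negP; apply.
  by have /forall_inP/(_ y yW)/implyP/(_ xy) := cW x xW.
Qed.

(** Koenig duality: a set [X] minimizing [#|~: X| + #|neighbours E X|] yields a matching of at least
    this size in the complement, whose pairs can share a colour, and a clique of [g] missing at most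
    this many vertices. *)
Lemma cobipartite_chromatic g : symmetric g -> irreflexive g ->
  bipartite (complement_graph g) -> chromatic_number g = clique_number g.
Proof.
move=> g_sym g_irr [h bip]; apply/eqP; rewrite eqn_leq clique_chromatic_le andbT.
pose E := [set p : T * T | [&& h p.1, ~~ h p.2 & complement_graph g p.1 p.2]].
have [X _ minX] : exists2 X : {set T}, true &
    forall Y : {set T}, #|~: X| + #|neighbours E X| <= #|~: Y| + #|neighbours E Y|.
  by case: (arg_minnP (fun Y : {set T} => #|~: Y| + #|neighbours E Y|)
    (erefl true : xpredT set0)) => X _ minX; exists X => // Y; apply: minX.
have [F [FE kF functional]] := rado_selection minX.
pose B := neighbours F setT.
have FB a b : (a, b) \in F -> b \in B.
  by move=> ab; apply/neighboursP; exists a.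
have EF a b : (a, b) \in F -> [&& h a, ~~ h b & complement_graph g a b].
  by move=> /(subsetP FE); rewrite inE.
(* In [F] each [a] has at most one [b]; choosing one [a] for each [b] turns [F] into a matching. *)
have [m mP] : exists m : T -> T, forall b, b \in B -> (m b, b) \in F.
  exists (fun b => odflt b [pick a | (a, b) \in F]) => b /neighboursP[a _ ab].
  by case: pickP => [//|/(_ a)]; rewrite ab.
have m_inj : {in B &, injective m}.
  move=> b b' bB b'B mm; apply: (functional (m b)); first exact: mP.
  by rewrite mm; apply: mP.
(* The vertex [m b] takes the colour [b] and all others keep their own, so no [m b] is used as a
   colour. *)
pose c := [ffun x => odflt x [pick b in B | m b == x]].
have cP x : (exists2 b, b \in B & m b = x /\ c x = b) \/
    (forall b, b \in B -> m b != x) /\ c x = x.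
  rewrite ffunE; case: pickP => [b /andP[bB /eqP mb]|none].
    by left; exists b.
  right; split=> // b bB; by have := none b; rewrite /= bB => /= ->.
have c_proper : proper_coloring g c.
  have key x y : g x y -> c x <> c y.
    move=> gxy; have [[b bB [mb ->]]|[_ ->]] := cP x;
      have [[b' b'B [mb' ->]]|[_ ->]] := cP y => cxy.
    - by move: gxy; rewrite -mb -mb' cxy g_irr.
    - by have /EF/and4P[_ _ _] := mP _ bB; rewrite mb cxy gxy.
    - by have /EF/and4P[_ _ _] := mP _ b'B; rewrite mb' -cxy g_sym gxy.
    - by move: gxy; rewrite cxy g_irr.
  by apply/forallP => x; apply/forallP => y; apply/implyP => /key/eqP.
rewrite (leq_trans (chromatic_number_le c_proper)) //.
(* These are the vertices outside the cover formed by [neighbours E X] and the part of [~: X] on the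
   side of [h]. *)
pose I := [set x | if h x then x \in X else x \notin neighbours E X].
have cI : clique g I.
  apply/forall_inP => x; rewrite inE => xI; apply/forall_inP => y; rewrite inE => yI.
  apply/implyP => xy; apply/negPn/negP => gxy.
  have {gxy} : complement_graph g x y by rewrite /complement_graph /= xy.
  wlog hx : x y xI yI xy / h x.
    move=> wl cxy; have := bip _ _ cxy; case hx: (h x) => hy; first exact: (wl x y).
    apply: (wl y x); rewrite 1?eq_sym //; first by case: (h y) hy.
    by rewrite /complement_graph /= eq_sym g_sym.
  move=> cxy; have := bip _ _ cxy; move: xI yI; rewrite hx.
  case hy: (h y) => // xX /neighboursP yN _; apply: yN.
  by exists x; rewrite // inE /= hx hy.
have : #|codom c| + #|m @: B| <= #|T|.
  rewrite -(cardsC (m @: B)) addnC leq_add2l.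
  apply/subset_leq_card/subsetP => _ /codomP[x ->]; rewrite inE.
  apply/imsetP => -[b bB cx]; have := mP _ bB; rewrite -cx => /EF/and3P[hc _ _].
  have [[b' b'B [_ cx']]|[nm cx']] := cP x.
    by have /EF/and3P[_ + _] := mP _ b'B; rewrite -cx' hc.
  by have := nm _ bB; rewrite -cx cx' eqxx.
rewrite card_in_imset // => cB.
have : #|I| <= clique_number g by apply: leq_bigmax_cond.
have : #|T| <= #|I| + (#|~: X| + #|neighbours E X|).
  rewrite -cardsT -(_ : I :|: (~: X :|: neighbours E X) = setT).
    rewrite (leq_trans (leq_card_setU _ _)) // leq_add2l.
    exact: leq_card_setU.
  apply/setP => x; rewrite !in_setU in_setC [x \in I]in_set in_setT.
  by case: (h x); case: (x \in X); case: (x \in neighbours E X).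
by move: kF cB; rewrite -/B; lia.
Qed.
End PerfectGraphs.

(** * Minimal nonbipartite edge sets *)

Section Circuits.
Variable T : finType.
Implicit Types (E F : {set T * T}) (p q : T * T).

Definition bipartite_edges F : bool :=
  [exists f : {ffun T -> bool}, [forall p in F, f p.1 != f p.2]].

(* In a simple graph these are exactly the edge sets of odd cycles, but only the
   minimality is ever used. *)
Definition odd_circuit F := minset (fun E => ~~ bipartite_edges E) F.

Definition covered F : {set T} := [set x | [exists p in F, (p.1 == x) || (p.2 == x)]].

Lemma coveredP F x :
  reflect (exists2 p, p \in F & (p.1 == x) || (p.2 == x)) (x \in covered F).
Proof. by rewrite inE; apply: (iffP exists_inP). Qed.

Lemma bipartite_edgesP F :
  reflect (exists f : T -> bool, forall p, p \in F -> f p.1 != f p.2)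
    (bipartite_edges F).
Proof.
apply: (iffP existsP) => [[f /forall_inP fF]|[f fF]]; first by exists f.
by exists [ffun x => f x]; apply/forall_inP => p /fF; rewrite !ffunE.
Qed.

Lemma bipartite_or_odd_circuit (g : rel T) :
  bipartite g \/ exists2 F, odd_circuit F & forall p, p \in F -> g p.1 p.2.
Proof.
pose E := [set p | g p.1 p.2].
have [/bipartite_edgesP[f fE]|nbip] := boolP (bipartite_edges E).
  by left; exists f => x y gxy; apply: (fE (x, y)); rewrite inE.
have [F circF FE] := minset_exists (P := fun E => ~~ bipartite_edges E) nbip.
by right; exists F => // p /(subsetP FE); rewrite inE.
Qed.

Lemma odd_circuit_not_bipartite F (f : T -> bool) : odd_circuit F ->
  (forall p, p \in F -> f p.1 != f p.2) -> False.
Proof. by move=> /minsetp /bipartite_edgesP F_nbip fF; apply: F_nbip; exists f. Qed.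

Lemma odd_circuit_sub F E : odd_circuit F -> E \proper F ->
  exists f : T -> bool, forall p, p \in E -> f p.1 != f p.2.
Proof.
move=> /minsetP[_ minF] EF; apply/bipartite_edgesP.
have [//|nbip] := boolP (bipartite_edges E).
by have EqF := minF E nbip (proper_sub EF); rewrite EqF properxx in EF.
Qed.

(** A 2-colouring of [F] minus [p] cannot separate the ends of [p] as well, since it would then
    colour all of [F]. *)
Lemma odd_circuit_coloring F p : odd_circuit F -> p \in F ->
  exists f : T -> bool, f p.1 = f p.2 /\
    forall q, q \in F -> q != p -> f q.1 != f q.2.
Proof.
move=> circF pF; have [f fF] := odd_circuit_sub circF (properD1 pF).
exists f; split=> [|q qF qp]; last by apply: fF; rewrite !inE qp.
apply/eqP/negPn/negP => fp; apply: (@odd_circuit_not_bipartite _ f circF) => q qF.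
by have [->//|qp] := eqVneq q p; apply: fF; rewrite !inE qp.
Qed.

(** Where [c] does not vanish, its sign alternates along the edges. If this happens at all, the
    edges on which [c] vanishes form a proper subset of [F] and have a 2-colouring, and the two
    colourings combine to one of [F]. *)
Lemma odd_circuit_kernel (R : realDomainType) F (c : T -> R) : odd_circuit F ->
  (forall p, p \in F -> c p.1 + c p.2 = 0)%R ->
  forall x, x \in covered F -> c x = 0%R.
Proof.
move=> circF cF x /coveredP[p pF px]; apply/eqP/negPn/negP => cx.
have cN q : q \in F -> c q.2 = (- c q.1)%R.
  by move=> /cF/eqP; rewrite addrC addr_eq0 => /eqP.
have cp : c p.1 != 0%R.
  by case/orP: px cx => /eqP <- //; rewrite cN // oppr_eq0.
have [|f fF] := @odd_circuit_sub F [set q in F | c q.1 == 0%R] circF.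
  apply/properP; split; first by apply/subsetP => q; rewrite inE => /andP[].
  by exists p; rewrite // inE (negPf cp) andbF.
pose f' x := if c x == 0%R then f x else (0 < c x)%R.
apply: (@odd_circuit_not_bipartite F f' circF) => q qF.
rewrite /f' cN // oppr_eq0; case: ifPn => cq; first by apply: fF; rewrite inE qF.
by rewrite oppr_gt0; case: ltgtP cq.
Qed.

Section Simple.
Variable F : {set T * T}.
Hypotheses (circF : odd_circuit F) (loopless : forall p, p \in F -> p.1 != p.2).

(** If [p] were the only edge at [x], flipping the colour of [x] in a colouring of [F] minus [p]
    would colour [F]. *)
Lemma odd_circuit_degree x : x \in covered F ->
  2 <= #|[set p in F | (p.1 == x) || (p.2 == x)]|.
Proof.
move=> /coveredP[p pF px]; rewrite ltnNge; apply/negP => /card_le1_eqP deg1.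
have [f [fp fF]] := odd_circuit_coloring circF pF.
pose f' y := f y (+) (y == x).
apply: (@odd_circuit_not_bipartite F f' circF) => q qF; rewrite /f'.
have [->|qp] := eqVneq q p.
  rewrite fp; have := loopless pF; case/orP: px => /eqP ->; rewrite eqxx.
    by rewrite eq_sym => /negPf ->; case: (f _).
  by move=> /negPf ->; case: (f _).
have : ~~ ((q.1 == x) || (q.2 == x)).
  apply: contraNN qp => qx; apply/eqP/deg1; rewrite inE ?qF ?qx //.
  by rewrite pF px.
by rewrite negb_or => /andP[/negPf-> /negPf->]; rewrite !addbF fF.
Qed.

(* The colourings of F minus one edge form a basis dual to the edges. *)
Lemma odd_circuit_card_le : #|F| <= #|covered F|.
Proof.
have /fin_all_exists[f fP] p : exists f : T -> bool, p \in F ->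
    f p.1 = f p.2 /\ forall q, q \in F -> q != p -> f q.1 != f q.2.
  have [pF|] := boolP (p \in F); last by exists (fun=> true).
  by have [f] := odd_circuit_coloring circF pF; exists f.
pose e (i : 'I_#|F|) := enum_val i; pose x (j : 'I_#|covered F|) := enum_val j.
pose A : 'M[rat]_(#|F|, #|covered F|) :=
  (\matrix_(i, j) (((e i).1 == x j) || ((e i).2 == x j))%:R)%R.
(* Column [k] is 1/2 on the colour of the ends of [e k] and -1/2 on the other colour, so it sums to
   1 over the ends of [e k] and to 0 over those of any other edge. *)
pose B : 'M[rat]_(#|covered F|, #|F|) :=
  (\matrix_(j, k) ((if f (e k) (x j) == f (e k) (e k).1 then 1 else - 1) / 2%:R))%R.
suff AB : (A *m B = 1%:M)%R by rewrite -(eqP (_ : row_free A)) ?rank_leq_col //;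
  apply/row_freeP; exists B.
apply/matrixP => i k; rewrite !mxE.
have eF : e i \in F := enum_valP i.
have cov y : ((e i).1 == y) || ((e i).2 == y) -> y \in covered F.
  by move=> ?; apply/coveredP; exists (e i).
pose G y : rat := ((if f (e k) y == f (e k) (e k).1 then 1 else - 1) / 2%:R)%R.
transitivity (G (e i).1 + G (e i).2)%R.
  transitivity (\sum_(y in covered F) (((e i).1 == y) || ((e i).2 == y))%:R * G y)%R.
    by rewrite [RHS]big_enum_val; apply: eq_bigr => j _; rewrite !mxE.
  have c1 : (e i).1 \in covered F by rewrite cov ?eqxx.
  have c2 : (e i).2 \in covered F by rewrite cov // eqxx orbT.
  rewrite (bigD1 (e i).1) //= eqxx mul1r; congr (_ + _)%R.
  rewrite (bigD1 (e i).2) /=; last by rewrite c2 eq_sym loopless.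
  rewrite eqxx orbT mul1r big1 ?addr0 // => y /andP[/andP[_ y1] y2].
  by rewrite eq_sym (negPf y1) eq_sym (negPf y2) mul0r.
rewrite /G; have [<-|ik] := eqVneq i k.
  by have [<- _] := fP _ eF; rewrite eqxx.
have [fk /(_ _ eF)] := fP (e k) (enum_valP k).
rewrite (inj_eq enum_val_inj) => /(_ ik).
by case: (f _ _); case: (f _ _); case: (f _ _).
Qed.

(** Every vertex of [I] lies on two edges and no edge has both ends in [I]. The inequality is strict
    because some edge misses [I]: otherwise membership in [I] would be a 2-colouring. *)
Lemma odd_circuit_independent (I : {set T}) : I \subset covered F ->
  (forall p, p \in F -> ~~ ((p.1 \in I) && (p.2 \in I))) ->
  2 * #|I| < #|covered F|.
Proof.
move=> IC indep; apply: leq_trans odd_circuit_card_le.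
have delta y : \sum_(x in I) (y == x : nat) = (y \in I).
  have [yI|yI] := boolP (y \in I).
    by rewrite (bigD1 y) //= eqxx big1 // => x /andP[_]; rewrite eq_sym => /negPf->.
  by rewrite big1 // => x xI; case: eqP yI => // ->; rewrite xI.
have [p pF pI] : exists2 p, p \in F & (p.1 \notin I) && (p.2 \notin I).
  have [/exists_inP //|] := boolP [exists p in F, (p.1 \notin I) && (p.2 \notin I)].
  rewrite negb_exists => /forallP touch; exfalso.
  apply: (@odd_circuit_not_bipartite F (mem I) circF) => p pF /=.
  by have := touch p; have := indep p pF; rewrite pF; case: (p.1 \in I); case: (p.2 \in I).
apply: leq_ltn_trans (_ : \sum_(q in F) ((q.1 \in I) + (q.2 \in I)) < _).
  under eq_bigr do rewrite -!delta -big_split /=.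
  rewrite exchange_big /= mulnC -sum_nat_const.
  apply: leq_sum => x /(subsetP IC) /odd_circuit_degree /leq_trans; apply.
  rewrite -sum1dep_card big_mkcondr /=.
  by apply: leq_sum => q qF; case: (q.1 == x); case: (q.2 == x).
rewrite -sum1_card [X in _ < X](bigD1 p) //= (bigD1 p) //=.
case/andP: pI => /negPf-> /negPf->; rewrite !add0n add1n ltnS.
apply: leq_sum => q /andP[qF _]; have := indep q qF.
by case: (q.1 \in I); case: (q.2 \in I).
Qed.

End Simple.
End Circuits.

(** * Perfect graphs and bipartite complements *)

Lemma perfect_cobipartite (T : finType) (g : rel T) :
  stability_number g <= 2 -> perfect g -> bipartite (complement_graph g).
Proof.
move=> g2 perf.
have [//|[F circF Fg]] := bipartite_or_odd_circuit (complement_graph g); exfalso.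
have loopless p : p \in F -> p.1 != p.2 by move=> /Fg /andP[].
set S := covered F; pose gS := induced_graph g (S := S).
have card_S : #|{: {x : T | x \in S}}| = #|S| by rewrite card_sig.
suff le_chi : #|S| <= 2 * chromatic_number gS.
  suff : 2 * clique_number gS < #|S| by rewrite -(perf S) ltnNge le_chi.
  (* The bound for the empty independent set covers the initial value 0 of the maximum. *)
  have S0 : 0 < #|S|.
    have := odd_circuit_independent circF loopless (sub0set S).
    by rewrite cards0; apply=> p _; rewrite !inE.
  apply: (big_ind (fun k => 2 * k < #|S|)) => //.
    by move=> i j; rewrite /maxn; case: ifP.
  move=> W /forall_inP cW; rewrite -(card_imset _ val_inj).
  apply: (odd_circuit_independent circF loopless).
    by apply/subsetP => _ /imsetP[x _ ->]; apply: (valP x).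
  move=> p pF; apply/negP => /andP[/imsetP[x xW px] /imsetP[y yW py]].
  have := Fg p pF; rewrite /complement_graph /= px py => /andP[xy /negP]; apply.
  have /forall_inP/(_ y yW)/implyP := cW x xW; apply.
  by apply: contraNneq xy => ->.
apply: (chromatic_number_ind (K := fun k => #|S| <= 2 * k)) => [|i j|f /forallP pf].
- by rewrite card_S; lia.
- by rewrite /minn; case: ifP.
(* The colour classes are stable, so each has at most two vertices. *)
rewrite -card_S -sum1_card (partition_big f (mem (codom f))) /=; last first.
  by move=> x _; apply: codom_f.
rewrite mulnC -sum_nat_const; apply: leq_sum => y _.
rewrite sum1dep_card -(card_imset _ val_inj); apply: leq_trans g2.
apply: leq_bigmax_cond; apply/forall_inP => _ /imsetP[x + ->].
rewrite inE => /eqP fx; apply/forall_inP => _ /imsetP[z + ->].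
rewrite inE => /eqP fz; apply/implyP => _; have /forallP/(_ z) := pf x.
by rewrite fx fz eqxx implybF.
Qed.

Lemma cobipartite_perfect (T : finType) (g : rel T) :
  symmetric g -> irreflexive g -> bipartite (complement_graph g) -> perfect g.
Proof.
move=> g_sym g_irr [h bip] S; apply: cobipartite_chromatic.
- by move=> x y; apply: g_sym.
- by move=> x; apply: g_irr.
- by exists (h \o val) => x y xy; apply: bip.
Qed.

From mathcomp Require Import all_classical all_reals.

(** * Affine geometry *)

Section AffineGeometry.
Local Open Scope classical_set_scope.
Local Open Scope ring_scope.
Variables (R : realType) (n : nat).
Local Notation vec := 'rV[R]_n.
Implicit Types (s t : {fset vec}) (c d x y v : vec) (b : R) (A P F : set vec).

Definition dot c x : R := \sum_j c 0 j * x 0 j.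

Fact dot_is_linear c : linear_for *%R (dot c).
Proof.
move=> k x y; rewrite /dot mulr_sumr -big_split; apply: eq_bigr => j _ /=.
by rewrite !mxE mulrDr mulrCA.
Qed.

HB.instance Definition _ c :=
  GRing.isLinear.Build R vec R *%R (dot c) (dot_is_linear c).

Lemma dotC c x : dot c x = dot x c.
Proof. by apply: eq_bigr => j _; rewrite mulrC. Qed.

Lemma dot_delta j x : dot (delta_mx 0 j) x = x 0 j.
Proof.
rewrite /dot (bigD1 j) //= mxE !eqxx mul1r big1 ?addr0 // => i ij.
by rewrite mxE (negPf ij) andbF mul0r.
Qed.

Lemma dotN c x : dot (- c) x = - dot c x.
Proof. by rewrite dotC linearN /= dotC. Qed.

Lemma dot0 x : dot 0 x = 0.
Proof. by rewrite dotC linear0. Qed.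

(* Dual form of the inclusion of P in the affine hull of A. *)
Definition affinely_spans A P := forall c b,
  (forall v, A v -> dot c v = b) -> forall x, P x -> dot c x = b.

Lemma convex_hull_incl A x : A x -> convex_hull A x.
Proof.
move=> Ax; exists 1, (fun=> x), (fun=> 1); split=> //.
  by rewrite big_ord1.
by rewrite big_ord1 scale1r.
Qed.

Lemma convex_hull_mono A P : A `<=` P -> convex_hull A `<=` convex_hull P.
Proof.
by move=> AP x [k [p [w [Ap w0 w1 ->]]]]; exists k, p, w; split=> // i; apply/AP.
Qed.

Lemma convex_hull_le A c b :
  (forall v, A v -> dot c v <= b) -> forall x, convex_hull A x -> dot c x <= b.
Proof.
move=> Ab x [k [p [w [Ap w0 w1 ->]]]]; rewrite linear_sum /=.
rewrite -[b]mul1r -w1 mulr_suml; apply: ler_sum => i _.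
by rewrite linearZ /= ler_wpM2l// Ab.
Qed.

Lemma convex_hull_spans A : affinely_spans A (convex_hull A).
Proof.
move=> c b Ab x Ax; apply/eqP; rewrite eq_le (convex_hull_le _ Ax) /=; last first.
  by move=> v /Ab ->.
by rewrite -lerN2 -dotN (convex_hull_le _ Ax) // => v /Ab <-; rewrite dotN.
Qed.

Lemma convex_hull0 x : ~ convex_hull (@set0 vec) x.
Proof.
move=> [[|k] [p [w [Ap w0 w1 _]]]]; last exact: Ap ord0.
by move: w1; rewrite big_ord0 => /esym/eqP; rewrite oner_eq0.
Qed.

(** Coinciding points of a family are merged by adding their weights. *)
Lemma convex_hull_seq (L : seq vec) x : uniq L ->
  convex_hull [set` L] x <->
  exists w : vec -> R, [/\ forall v, v \in L -> 0 <= w v,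
    \sum_(v <- L) w v = 1 & x = \sum_(v <- L) w v *: v].
Proof.
move=> uL; split.
  move=> [k [p [w [Ap w0 w1 ->]]]].
  (* Stated for a general module, to be used with [R^o] for the total weight and with [vec] for the
     point. *)
  have sumP (V : lmodType R) (f : vec -> V) :
      \sum_(v <- L) (\sum_(i | p i == v) w i) *: f v = \sum_i w i *: f (p i).
    under eq_bigr do rewrite scaler_suml big_mkcond.
    rewrite exchange_big /=; apply: eq_bigr => i _.
    rewrite -big_mkcond -(big_filter _ (fun v => p i == v)).
    rewrite (_ : [seq v <- L | p i == v] = [:: p i]) ?big_seq1 //.
    have /= := filter_pred1_uniq uL (Ap i).
    by under eq_filter do rewrite /= eq_sym.
  exists (fun v => \sum_(i | p i == v) w i); split.
  - by move=> v _; apply: sumr_ge0.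
  - rewrite -w1; have := sumP R^o (fun=> 1).
    by under eq_bigr do rewrite /GRing.scale /= mulr1; move->;
       apply: eq_bigr => i _; rewrite /GRing.scale /= mulr1.
  - by rewrite (sumP _ idfun).
move=> [w [w0 w1 ->]].
exists (size L), (fun i => nth 0 L i), (fun i => w (nth 0 L i)); split.
- by move=> i; apply: mem_nth.
- by move=> i; apply/w0/mem_nth.
- by rewrite -w1 (big_nth 0) big_mkord.
- by rewrite (big_nth 0) big_mkord.
Qed.

(** The rows [(1, v)] for [v] in [s] are linearly independent; a column of a right inverse of their
    matrix holds the coefficients of a barycentric coordinate. *)
Lemma affinely_independent_dual s v : affinely_independent s -> v \in s ->
  exists c b, dot c v - b = 1 /\
    forall u, u \in s -> u != v -> dot c u = b.
Proof.
move=> indep vs; set m := size s; have us : uniq s := fset_uniq s.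
pose A := \matrix_(i < m) row_mx (const_mx 1 : 'rV[R]_1) (nth 0 s i).
have /row_freeP [B AB] : row_free A.
  apply: inj_row_free => z zA.
  pose w u := \sum_(i < m | nth 0 s i == u) z 0 i.
  have sumw (V : lmodType R) (f : vec -> V) :
      \sum_(u <- s) w u *: f u = \sum_i z 0 i *: f (nth 0 s i).
    rewrite (big_nth 0) big_mkord; apply: eq_bigr => i _; congr (_ *: _).
    rewrite /w (bigD1 i) //= big1 ?addr0 // => j /andP[].
    by rewrite nth_uniq // => /eqP/val_inj ->; rewrite eqxx.
  have row0 : \sum_i z 0 i *: row i A = 0 by rewrite -mulmx_sum_row.
  have w1 : \sum_(u <- s) w u = 0.
    have := sumw R^o (fun=> 1).
    under eq_bigr do rewrite /GRing.scale /= mulr1.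
    move=> ->; have /rowP/(_ (lshift _ 0)) := row0.
    rewrite summxE mxE => {2}<-; apply: eq_bigr => i _.
    by rewrite 3!mxE row_mxEl mxE.
  have w2 : \sum_(u <- s) w u *: u = 0.
    rewrite (sumw _ idfun); apply/rowP => j; have /rowP/(_ (rshift _ j)) := row0.
    rewrite !summxE !mxE => {2}<-; apply: eq_bigr => i _.
    by rewrite 4!mxE row_mxEr.
  apply/rowP => i; rewrite mxE.
  have := indep w w1 w2 (nth 0 s i) (mem_nth _ (ltn_ord i)).
  rewrite /w (bigD1 i) //= big1 ?addr0 // => j /andP[].
  by rewrite nth_uniq // => /eqP/val_inj ->; rewrite eqxx.
have iv : (index v s < m)%N by rewrite index_mem.
pose k := Ordinal iv.
exists (\row_j B (rshift _ j) k), (- B (lshift _ 0) k).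
have E u : u \in s -> dot (\row_j B (rshift 1 j) k) u - - B (lshift n 0) k = (u == v)%:R.
  move=> ju; have iu : (index u s < m)%N by rewrite index_mem.
  have /matrixP/(_ (Ordinal iu) k) := AB.
  rewrite !mxE big_split_ord big_ord1 /= -val_eqE /=.
  rewrite (inj_in_eq (@index_inj _ 0 s)) //.
  move=> <-; rewrite opprK addrC; congr (_ + _).
    by apply: eq_bigr => j _; rewrite 2!mxE row_mxEr mulrC nth_index.
  by rewrite mxE row_mxEl mxE mul1r.
split; first by rewrite E // eqxx.
by move=> u ju uv; apply/eqP; rewrite -subr_eq0 E // (negPf uv).
Qed.

(** The barycentric coordinate of an additional vertex would be 0 on [s], hence on [P], but 1 at
    that vertex. *)
Lemma spanning_simplex_maximal s t P : affinely_spans [set` s] P ->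
  affinely_independent t -> (forall v, v \in t -> P v) -> (s `<=` t)%fset -> t = s.
Proof.
move=> spans indep tP st; apply/eqP; rewrite eqEfsubset st andbT.
apply/fsubsetP => u ut; apply/negPn/negP => us.
have [c [b [cu cv]]] := affinely_independent_dual indep ut.
move: cu; rewrite (spans c b) ?subrr; last exact: tP.
  by move=> /esym/eqP; rewrite oner_eq0.
move=> v vs; apply: cv; first exact: (fsubsetP st).
by apply: contraNneq us => <-.
Qed.

Lemma separated_affinely_independent s :
  (forall v, v \in s -> exists c b, dot c v != b /\
    forall u, u \in s -> u != v -> dot c u = b) -> affinely_independent s.
Proof.
move=> sep w w1 w2 v vs; have [c [b [cv cu]]] := sep v vs.
have : \sum_(u <- s) w u * (dot c u - b) = 0.
  under eq_bigr do rewrite mulrBr.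
  rewrite sumrB -mulr_suml w1 mul0r subr0.
  have := congr1 (dot c) w2; rewrite linear0 linear_sum /=.
  by under eq_bigr do rewrite linearZ /=.
rewrite (bigD1_seq v) ?fset_uniq //= big1_seq ?addr0; last first.
  by move=> u /andP[uv us]; rewrite cu // subrr mulr0.
by move=> /eqP; rewrite mulf_eq0 subr_eq0 (negPf cv) orbF => /eqP.
Qed.

(** An affine functional and its interpolation from the vertices agree on [s], hence on [P]. The
    constant 1 and the coordinates give the two claims. *)
Lemma dual_expansion s (c : vec -> vec) (b : vec -> R) P x :
  affinely_spans [set` s] P -> P x ->
  (forall v, v \in s -> dot (c v) v - b v = 1 /\
    forall u, u \in s -> u != v -> dot (c v) u = b v) ->
  \sum_(v <- s) (dot (c v) x - b v) = 1 /\
  x = \sum_(v <- s) (dot (c v) x - b v) *: v.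
Proof.
move=> sP Px dual.
have expand d e : dot d x - e = \sum_(v <- s) (dot (c v) x - b v) * (dot d v - e).
  pose d' := d - \sum_(v <- s) (dot d v - e) *: c v.
  pose e' := e - \sum_(v <- s) (dot d v - e) * b v.
  have E y : dot d' y - e' =
      dot d y - e - \sum_(v <- s) (dot (c v) y - b v) * (dot d v - e).
    rewrite /d' dotC raddfB /= linear_sum /= dotC.
    have -> : \sum_(v <- s) dot y ((dot d v - e) *: c v) =
        \sum_(v <- s) (dot (c v) y - b v) * (dot d v - e) +
        \sum_(v <- s) (dot d v - e) * b v.
      rewrite -big_split /=; apply: eq_bigr => v _.
      by rewrite linearZ /= [dot y _]dotC; ring.
    by rewrite /e'; ring.
  have : dot d' x = e'.
    apply: (sP d' e') => // v /= vs; apply/eqP; rewrite -subr_eq0 E.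
    rewrite (bigD1_seq v) ?fset_uniq //= big1_seq ?addr0.
      by have [-> _] := dual v vs; rewrite mul1r subrr.
    move=> u /andP[uv us]; have [_ ->] := dual u us; rewrite ?subrr ?mul0r //.
    by rewrite eq_sym.
  by move/eqP; rewrite -subr_eq0 E subr_eq0 => /eqP.
split.
  have := expand 0 (-1); rewrite dot0 sub0r opprK => ->.
  by apply: eq_bigr => v _; rewrite dot0 add0r mulr1.
apply/rowP => j; rewrite summxE -dot_delta -[LHS]subr0 expand.
by apply: eq_bigr => v _; rewrite subr0 dot_delta !mxE.
Qed.

End AffineGeometry.

(** * The stable set polytope *)

Section StableSetPolytope.
Local Open Scope classical_set_scope.
Local Open Scope ring_scope.
Variables (R : realType) (n : nat) (e : rel 'I_n).
Local Notation vec := 'rV[R]_n.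
Local Notation Q := (stable_set_polytope R e).
Local Notation ind := (@indicator_vector R n).
Implicit Types (s t : {fset vec}) (c x v : vec) (W : {set 'I_n}).

Lemma indicatorE W j : ind W 0 j = (j \in W)%:R.
Proof. by rewrite mxE. Qed.

Lemma indicator_inj : injective (ind : {set 'I_n} -> vec).
Proof.
move=> W W' /rowP WW'; apply/setP => j; have := WW' j; rewrite !indicatorE.
by case: (j \in W); case: (j \in W') => // /eqP; rewrite ?oner_eq0 // eq_sym oner_eq0.
Qed.

Lemma dot_indicator c W : dot c (ind W) = \sum_(j in W) c 0 j.
Proof.
rewrite [RHS]big_mkcond; apply: eq_bigr => j _; rewrite indicatorE.
by case: (j \in W); rewrite ?mulr1 ?mulr0.
Qed.

Lemma stable_sub W W' : W \subset W' -> stable e W' -> stable e W.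
Proof.
move=> WW' /forall_inP sW'; apply/forall_inP => x /(fintype.subsetP WW') /sW' /forall_inP sx.
by apply/forall_inP => y /(fintype.subsetP WW') /sx.
Qed.

Lemma stable0 : stable e finset.set0.
Proof. by apply/forall_inP => x; rewrite inE. Qed.

Lemma stable1 i : stable e [set i]%SET.
Proof.
apply/forall_inP => x /set1P ->; apply/forall_inP => y /set1P ->.
by rewrite eqxx.
Qed.

Lemma stable2 i j : symmetric e -> complement_graph e i j -> stable e [set i; j]%SET.
Proof.
move=> e_sym /andP[_ eij]; apply/forall_inP => x /set2P xij.
apply/forall_inP => y /set2P yij; apply/implyP.
by case: xij => ->; case: yij => ->; rewrite ?eqxx // e_sym.
Qed.

Lemma polytope_indicator W : stable e W -> Q (ind W).
Proof. by move=> sW; apply: convex_hull_incl; exists W. Qed.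

Lemma polytope_ge0 x j : Q x -> 0 <= x 0 j.
Proof.
rewrite -oppr_le0 -dot_delta -dotN; apply: convex_hull_le => _ [W _ <-].
by rewrite dotN dot_delta indicatorE oppr_le0 ler0n.
Qed.

Lemma polytope_le1 x j : Q x -> x 0 j <= 1.
Proof.
rewrite -dot_delta; apply: convex_hull_le => _ [W _ <-].
by rewrite dot_delta indicatorE lern1 leq_b1.
Qed.

(** Coordinates lie between 0 and 1, so a lattice point is the indicator of some [W]. A generator
    with nonzero weight must be 1 wherever the point is, so [W] lies in a stable set. *)
Lemma lattice_pointsE :
  lattice_points Q = [set x | exists2 W, stable e W & x = ind W].
Proof.
apply/seteqP; split=> [x [Qx xint]|_ [W sW ->]] /=; last first.
  split; first exact: polytope_indicator.
  by move=> j /=; rewrite indicatorE natr_int.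
pose W := [set j | x 0 j == 1]%SET.
have xW j : x 0 j = (j \in W)%:R.
  rewrite inE; have := polytope_ge0 j Qx; have := polytope_le1 j Qx.
  have /intrP[m ->] := xint j; rewrite -[1]/(1%:~R) ler_int ler0z eqr_int.
  by case: m => [[|[|m]]|m].
have xE : x = ind W by apply/rowP => j; rewrite xW indicatorE.
exists W => //; have [k [p [w [Qp w0 w1 xp]]]] := Qx.
have [i wi] : exists i, w i != 0.
  apply/existsP; apply: contraPT w1; rewrite negb_exists => /forallP wN.
  rewrite big1 => [/esym/eqP|i _]; first by rewrite oner_eq0.
  by have := wN i; rewrite negbK => /eqP.
have [V sV pV] := Qp i; apply: stable_sub sV; apply/fintype.subsetP => j jW.
have p1 l : p l 0 j <= 1.
  by have [V' _ <-] := Qp l; rewrite indicatorE lern1 leq_b1.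
have : \sum_l w l * (1 - p l 0 j) = 0.
  under eq_bigr do rewrite mulrBr mulr1.
  have xj : \sum_l w l * p l 0 j = 1.
    have x1 : x 0 j = 1 by rewrite xW jW.
    rewrite -x1 xp summxE.
    by apply: eq_bigr => l _; rewrite mxE.
  by rewrite sumrB w1 xj subrr.
have p1w l : 0 <= w l * (1 - p l 0 j) by rewrite mulr_ge0 // subr_ge0.
move=> /(psumr_eq0P (fun l _ => p1w l)) /(_ i isT) /eqP;
  rewrite mulf_eq0 (negPf wi) subr_eq0 /=.
by rewrite -pV indicatorE; case: (j \in V); rewrite ?oner_eq0.
Qed.

Section Cobipartite.
Variable h : 'I_n -> bool.
Hypothesis bip : forall i j, complement_graph e i j -> h i != h j.

(** Each colour class is a clique of [e]. The alternatives have the form of predicates that collapse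
    a sum to one term or none. *)
Lemma stable_side W k : stable e W ->
  (exists a, h a = k /\ forall j, (j \in W) && (h j == k) = (j == a)) \/
  (forall j, (j \in W) && (h j == k) = false).
Proof.
move=> sW; case: (pickP (fun j => (j \in W) && (h j == k))) => [a|none].
  move=> /andP[aW /eqP ha]; left; exists a; split=> // j.
  apply/idP/eqP => [/andP[jW /eqP hj]|->]; last by rewrite aW ha eqxx.
  apply/eqP/negPn/negP => ja; have /forall_inP/(_ a aW) := forall_inP sW j jW.
  move=> /implyP/(_ ja) eja.
  have /bip : complement_graph e j a by rewrite /complement_graph /= ja.
  by rewrite hj ha eqxx.
by right=> j; have := none j.
Qed.

(* Adding a new vertex to each colour class turns every stable set into an edge, on
   which dot c - b is the sum of two vertex weights: c and 0 on one class, c - b and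
   -b on the other. The functional c' compares the integrality of the two weights; it
   vanishes on S, hence on all stable sets, and so all weights are integral. *)
Lemma cobipartite_integral (S : set vec) c b :
  affinely_spans S Q -> S `<=` lattice_points Q ->
  (forall v, S v -> dot c v - b \is a Num.int) ->
  forall x, lattice_points Q x -> dot c x - b \is a Num.int.
Proof.
move=> spanS; rewrite lattice_pointsE => latS intS.
have split_dot c' W : dot c' (ind W) =
    \sum_(j | (j \in W) && (h j == true)) c' 0 j +
    \sum_(j | (j \in W) && (h j == false)) c' 0 j.
  rewrite dot_indicator (bigID h) /=; congr (_ + _); apply: eq_bigl => j.
    by rewrite eqb_id.
  by rewrite eqbF_neg.
pose Z (y : R) : R := (y \is a Num.int)%:R.
have Z_eq y z : y - z \is a Num.int -> Z y = Z z.
  by move=> yz; rewrite /Z -[y](subrK z) rpredDl.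
have Z1 y : Z y = 1 -> y \is a Num.int.
  by rewrite /Z; case: (y \is a _) => // /eqP; rewrite eq_sym oner_eq0.
pose c' : vec := \row_j if h j then Z (c 0 j) - 1 else Z b - Z (c 0 j - b).
have c'P v : S v -> dot c' v = Z b - 1.
  move=> Sv; have [W sW vW] := latS v Sv; have := intS v Sv.
  rewrite vW !split_dot.
  have [[i [hi iP]]|iP] := stable_side true sW;
  have [[j [hj jP]]|jP] := stable_side false sW;
  rewrite !(eq_bigl _ _ iP) !(eq_bigl _ _ jP) ?big_pred1_eq ?big_pred0_eq ?mxE ?hi ?hj
    ?add0r ?addr0.
  - rewrite -addrA -[X in _ + X]opprK => /Z_eq ->.
    have -> : Z (- (c 0 j - b)) = Z (c 0 j - b) by rewrite /Z rpredN.
    by rewrite addrC; ring.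
  - by move=> /Z_eq ->.
  - by move=> cb; rewrite {2}/Z cb.
  - by rewrite rpredN => bi; rewrite {1}/Z bi subrr.
have c'Q W : stable e W -> dot c' (ind W) = Z b - 1.
  by move=> sW; apply: (spanS c' _ c'P); apply: polytope_indicator.
have Zb : b \is a Num.int.
  apply/Z1/eqP; rewrite -subr_eq0 -(c'Q finset.set0) ?stable0 //.
  by rewrite dot_indicator big_set0.
have c'j j : c' 0 j = 0.
  have := c'Q [set j]%SET; rewrite dot_indicator big_set1 => -> //; last exact: stable1.
  by rewrite /Z Zb subrr.
have Zc j : c 0 j \is a Num.int.
  have := c'j j; rewrite mxE; case: (h j) => [/eqP|].
    by rewrite subr_eq0 => /eqP/Z1.
  by rewrite /Z Zb => /eqP; rewrite subr_eq0 => /eqP/esym/Z1; rewrite rpredBr.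
by move=> _ [W _ ->]; rewrite dot_indicator rpredB // rpred_sum.
Qed.

Lemma cobipartite_unimodular_simplex s :
  affinely_independent s -> [set` s] `<=` lattice_points Q ->
  affinely_spans [set` s] Q -> unimodular_simplex Q s.
Proof.
move=> indep lat spans; split=> // x latx.
have /choice[c /choice[b dual]] : forall v, exists c, exists b, v \in s ->
    dot c v - b = 1 /\ forall u, u \in s -> u != v -> dot c u = b.
  move=> v; have [vs|] := boolP (v \in s); last by exists 0, 0.
  by have [c [b cb]] := affinely_independent_dual indep vs; exists c, b.
have [sum1 sumx] := dual_expansion spans (latx.1) dual.
have wint v : v \in s -> dot (c v) x - b v \is a Num.int.
  move=> vs; apply: (cobipartite_integral spans lat) => // u us.
  have [duu dvu] := dual v vs.
  by have [->|uv] := eqVneq u v; rewrite ?duu ?rpred1 // dvu // subrr rpred0.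
(* The coordinates are integral already; the floor only moves them to [int]. *)
exists (fun v => Num.floor (dot (c v) x - b v)); split.
  apply: (@intr_inj R); rewrite rmorph_sum /=; apply: etrans sum1.
  by apply: eq_big_seq => v vs; rewrite floorK ?wint.
by rewrite {1}sumx; apply: eq_big_seq => v vs; rewrite -scaler_int floorK ?wint.
Qed.

End Cobipartite.

End StableSetPolytope.

(** * Maximal simplices of triangulations *)

Section Triangulations.
Local Open Scope classical_set_scope.
Local Open Scope ring_scope.
Variables (R : realType) (n : nat).
Local Notation vec := 'rV[R]_n.
Implicit Types (s t : {fset vec}) (c x y v : vec) (A P : set vec).

Lemma convex_hull_convex A x y (k : R) : convex_hull A x -> convex_hull A y ->
  0 <= k <= 1 -> convex_hull A ((1 - k) *: x + k *: y).
Proof.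
move=> [l [p [w [Ap w0 w1 ->]]]] [m [q [u [Aq u0 u1 ->]]]] /andP[k0 k1].
exists (l + m)%N, (fun i => match fintype.split i with inl i => p i | inr j => q j end),
  (fun i => match fintype.split i with inl i => (1 - k) * w i | inr j => k * u j end).
have splitl i : fintype.split (lshift m i) = inl i by apply: (unsplitK (inl i)).
have splitr j : fintype.split (rshift l j) = inr j by apply: (unsplitK (inr j)).
split.
- by move=> i; case: fintype.splitP.
- by move=> i; case: fintype.splitP => j _; rewrite mulr_ge0 ?subr_ge0.
- rewrite big_split_ord /=.
  under eq_bigr do rewrite splitl; under [X in _ + X]eq_bigr do rewrite splitr.
  by rewrite -!mulr_sumr w1 u1 !mulr1 subrK.
- rewrite big_split_ord /=.
  under [in RHS]eq_bigr do rewrite splitl -scalerA.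
  under [X in _ = _ + X]eq_bigr do rewrite splitr -scalerA.
  by rewrite !scaler_sumr.
Qed.

(** This and the next lemma replace passing to the limit as [k] tends to 0. *)
Lemma ge0_near0 (a b : R) :
  (forall d, 0 < d -> exists2 k, 0 < k < d & 0 <= a + k * b) -> 0 <= a.
Proof.
move=> near; rewrite leNgt; apply/negP => a0.
have d0 : 0 < `|b| + 1 by rewrite ltr_wpDl.
have [|k /andP[k0 kd]] := near (- a / (`|b| + 1)).
  by rewrite divr_gt0 // oppr_gt0.
move: kd; rewrite ltr_pdivlMr // => kd; apply/negP; rewrite -ltNge.
by have := ler_norm b => bb; nra.
Qed.

Lemma eq0_near0 (a b : R) :
  (forall d, 0 < d -> exists2 k, 0 < k < d & a + k * b = 0) -> a = 0.
Proof.
move=> near; apply/eqP; rewrite eq_le -oppr_ge0.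
apply/andP; split; [apply: (@ge0_near0 _ (- b))|apply: (@ge0_near0 _ b)];
  move=> d /near[k kd kab]; exists k => //; last by rewrite kab.
by rewrite mulrN -opprD kab oppr0.
Qed.

(** Pigeonhole: if each member of [D] failed below a threshold of its own, all would fail below the
    least threshold. *)
Lemma finite_near0 (T : eqType) (D : seq T) (H : T -> R -> Prop) :
  (forall d, 0 < d -> exists2 k, 0 < k < d & exists2 t, t \in D & H t k) ->
  exists2 t, t \in D & forall d, 0 < d -> exists2 k, 0 < k < d & H t k.
Proof.
elim: D => [|t D IHD] near; first by have [k _ []] := near 1 ltr01.
have [tnear|] := pselect (forall d, 0 < d -> exists2 k, 0 < k < d & H t k).
  by exists t; rewrite // mem_head.
move=> /existsNP[d0 /not_implyP[d0_gt0 /forall2NP Nt]].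
have [d d_gt0|u uD unear] := IHD; last by exists u; rewrite // in_cons uD orbT.
have [|k /andP[k0 kd] [u]] := near (Num.min d d0); first by rewrite lt_min d_gt0.
move: kd; rewrite lt_min in_cons => /andP[kd kd0] /orP[/eqP -> Htk|uD Huk].
  by have [|] := Nt k; rewrite // k0 kd0.
by exists k; rewrite ?k0 //; exists u.
Qed.

(** Equations and weak inequalities pass to limits, so this form shows that a simplex is closed. *)
Lemma convex_hull_of_dual t (c : vec -> vec) (b : vec -> R) x :
  (forall v, v \in t -> dot (c v) v - b v = 1 /\
    forall u, u \in t -> u != v -> dot (c v) u = b v) ->
  convex_hull [set` t] x <->
  affinely_spans [set` t] [set x] /\ forall v, v \in t -> b v <= dot (c v) x.
Proof.
move=> dual; split=> [tx|[spans bc]].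
  split=> [d f df _ ->|v vt]; first exact: convex_hull_spans tx.
  rewrite -lerN2 -dotN; apply: convex_hull_le tx => u ut.
  rewrite dotN lerN2; have [cv cu] := dual v vt.
  have [->|uv] := eqVneq u v; last by rewrite cu.
  by rewrite -subr_ge0 cv ler01.
have [sum1 sumx] := dual_expansion spans (erefl x) dual.
apply/convex_hull_seq; first exact: fset_uniq.
by exists (fun v => dot (c v) x - b v); split=> // v vt; rewrite subr_ge0 bc.
Qed.

(** From the barycentre [x] of [s], move towards a point [y] of [P]. By finiteness one simplex [t]
    contains points [z k] with [k] arbitrarily small, hence also [x]. Then [t] contains [s], so it
    equals [s], and a functional constant on [s] has the same value at [x], at some [z k] and at
    [y]. *)
Lemma triangulation_maximal_spans P (D : set {fset vec}) s :
  (forall x y k, P x -> P y -> 0 <= k <= 1 -> P ((1 - k) *: x + k *: y)) ->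
  P !=set0 -> triangulation P D -> maximal_simplex D s ->
  affinely_spans [set` s] P.
Proof.
move=> convP [x0 Px0] [/finite_fsetP[Ds DsE] indepD _ interD coverD] [Ds_s maxs].
have cover x : P x -> exists2 t, D t & convex_hull [set` t] x.
  by rewrite -coverD => -[t Dt tx]; exists t.
have s0 : (0 < size s)%N.
  rewrite lt0n cardfs_eq0; apply/negP => /eqP s0; have [t Dt tx] := cover x0 Px0.
  have ts : t = s by apply: maxs => //; rewrite s0 fsub0set.
  apply: (@convex_hull0 R n x0); apply: convex_hull_mono tx => v /=.
  by rewrite ts s0 in_fset0.
have [indep _] := indepD s Ds_s.
have /choice[cs /choice[bs duals]] : forall v, exists c, exists b, v \in s ->
    dot c v - b = 1 /\ forall u, u \in s -> u != v -> dot c u = b.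
  move=> v; have [vs|] := boolP (v \in s); last by exists 0, 0.
  by have [c [b cb]] := affinely_independent_dual indep vs; exists c, b.
pose m : R := (size s)%:R; have m0 : m != 0 by rewrite pnatr_eq0 -lt0n.
pose x := \sum_(v <- s) m^-1 *: v.
have sumV : \sum_(v <- s) m^-1 = 1.
  by rewrite big_const_seq count_predT iter_addr_0 -[RHS](mulVf m0) mulr_natr.
have sx : convex_hull [set` s] x.
  apply/convex_hull_seq; first exact: fset_uniq.
  by exists (fun=> m^-1); split=> // v _; rewrite invr_ge0 ler0n.
have Px : P x by rewrite -coverD; exists s.
move=> c b cb y Py; pose z k := (1 - k) *: x + k *: y.
have zE d f k : dot d (z k) - f = (dot d x - f) + k * (dot d y - dot d x).
  by rewrite linearD !linearZ /=; ring.
have [t tD near] : exists2 t, t \in Ds &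
    forall d, 0 < d -> exists2 k, 0 < k < d & convex_hull [set` t] (z k).
  apply: finite_near0 => d d0; exists (Num.min d 1 / 2).
    rewrite divr_gt0 ?lt_min ?d0 ?ltr01 //= ltr_pdivrMr //.
    by rewrite (@le_lt_trans _ _ d) ?ge_min ?lexx //; lra.
  have [|t Dt tz] := cover (z (Num.min d 1 / 2)).
    apply: convP => //; rewrite divr_ge0 ?le_min ?(ltW d0) ?ler01 //=.
    by rewrite ler_pdivrMr // ge_min; apply/orP; right; lra.
  by exists t => //; move: Dt; rewrite DsE.
have Dt : D t by rewrite DsE.
have [indept _] := indepD t Dt.
have /choice[ct /choice[bt dualt]] : forall v, exists c, exists b, v \in t ->
    dot c v - b = 1 /\ forall u, u \in t -> u != v -> dot c u = b.
  move=> v; have [vt|] := boolP (v \in t); last by exists 0, 0.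
  by have [c' [b' cb']] := affinely_independent_dual indept vt; exists c', b'.
have tx : convex_hull [set` t] x.
  apply/(convex_hull_of_dual _ dualt); split=> [d f df _ ->|v vt].
    apply/eqP; rewrite -subr_eq0; apply/eqP/(@eq0_near0 _ (dot d y - dot d x)).
    move=> k0 /near[k kk0 tz]; exists k => //; rewrite -zE.
    by rewrite (convex_hull_spans df tz) subrr.
  rewrite -subr_ge0; apply: (@ge0_near0 _ (dot (ct v) y - dot (ct v) x)).
  move=> k0 /near[k kk0 tz]; exists k => //; rewrite -zE subr_ge0.
  by move/(convex_hull_of_dual _ dualt): tz => [_]; apply.
(* The point [x] lies in the hull of the common vertices, so a vertex of [s] outside [t] would have
   coordinate 0 at [x] instead of [m^-1]. *)
have st : (s `<=` t)%fset.
  apply/fsubsetP => v vs; apply/negPn/negP => vt; have [cv cu] := duals v vs.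
  have stx : convex_hull [set` (s `&` t)%fset] x by rewrite -interD.
  have : dot (cs v) x - bs v = m^-1.
    rewrite linear_sum /= -[bs v]mul1r -sumV mulr_suml -sumrB.
    rewrite (bigD1_seq v) ?fset_uniq //= linearZ /= -mulrBr cv mulr1.
    rewrite big1_seq ?addr0 // => u /andP[uv us].
    by rewrite linearZ /= -mulrBr cu // subrr mulr0.
  rewrite (convex_hull_spans (b := bs v) _ stx) ?subrr.
    by move=> /esym/eqP; rewrite invr_eq0 (negPf m0).
  move=> u /=; rewrite in_fsetI => /andP[us ut]; apply: cu => //.
  by apply: contraNneq vt => <-.
have ts := maxs t Dt st; have [k /andP[k0 _]] := near 1 ltr01.
rewrite ts => /(convex_hull_spans cb) /eqP; rewrite -subr_eq0 zE.
rewrite (convex_hull_spans cb sx) subrr add0r mulf_eq0 gt_eqF //= subr_eq0.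
by move=> /eqP.
Qed.

End Triangulations.

(** * Pulling triangulations *)

Lemma seq_least (T : eqType) (le : rel T) (s : seq T) x : total le -> transitive le ->
  x \in s -> exists2 y, y \in s & forall z, z \in s -> le y z.
Proof.
move=> le_tot le_tr; elim: s x => // u [|v s] IHs x _.
  exists u => [|z]; first exact: mem_head.
  by rewrite inE => /eqP ->; have /orP[] := le_tot u u.
have [y ys ymin] := IHs v (mem_head v s); have [uy|yu] := orP (le_tot u y).
  exists u => [|z]; first exact: mem_head.
  rewrite in_cons => /orP[/eqP->|/ymin]; last exact: le_tr.
  by have /orP[] := le_tot u u.
exists y => [|z]; first by rewrite in_cons ys orbT.
by rewrite in_cons => /orP[/eqP->|/ymin].
Qed.

Section Pulling.
Local Open Scope classical_set_scope.
Local Open Scope ring_scope.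
Variables (R : realType) (n : nat).
Local Notation vec := 'rV[R]_n.
Variable a : seq vec.
Implicit Types (s t : {fset vec}) (c d x y v : vec) (F P : set vec).

Definition points P : seq vec := [seq u <- a | u \in P].

Definition spanned P := P = convex_hull [set` points P].

Lemma pointsP P v : v \in points P <-> v \in a /\ P v.
Proof.
rewrite mem_filter; split=> [/andP[/set_mem]|[va /mem_set ->]//]; first by [].
Qed.

Lemma size_points_lt F P v : F `<=` P -> v \in a -> P v -> ~ F v ->
  (size (points F) < size (points P))%N.
Proof.
move=> FP va Pv Fv; rewrite /points -(count_predC (mem F) [seq u <- a | u \in P]).
rewrite -size_filter -filter_predI -[X in (X < _)%N]addn0 -addnS leq_add //.
  apply/eq_leq; congr size; apply: eq_filter => u /=; apply/idP/andP => [uF|[]//].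
  by split=> //; apply/mem_set/FP/set_mem.
rewrite -has_count; apply/hasP; exists v; first exact/pointsP.
by apply/negP => /set_mem.
Qed.

Lemma face_subset P F : face P F -> F `<=` P.
Proof. by move=> [c [b [_ ->]]] x []. Qed.

(** An average of values at most [b] equals [b] only if every point of nonzero weight attains
    [b]. *)
Lemma face_spanned P F : spanned P -> face P F -> spanned F.
Proof.
move=> hP [c [b [cb FE]]]; apply/seteqP; split=> x; last first.
  move=> Fx; rewrite FE; split.
    rewrite hP; apply: convex_hull_mono Fx => v /= /pointsP[va].
    by rewrite FE => -[Pv _]; apply/pointsP.
  apply: (convex_hull_spans (A := [set` points F])) Fx => v /= /pointsP[_].
  by rewrite FE => -[].
rewrite {1}FE hP => -[[k [p [w [Pp w0 w1 xp]]]]]; rewrite /= -/(dot c x) => cx.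
have {}Pp i : p i \in a /\ P (p i) by apply/pointsP/(Pp i).
have tight i : w i != 0 -> dot c (p i) = b.
  move=> wi; have : \sum_j w j * (b - dot c (p j)) = 0.
    under eq_bigr do rewrite mulrBr.
    rewrite sumrB -mulr_suml w1 mul1r -cx xp linear_sum /=.
    by under [in X in _ - X]eq_bigr do rewrite -linearZ; rewrite subrr.
  have pos j : 0 <= w j * (b - dot c (p j)).
    by rewrite mulr_ge0 // subr_ge0; apply: cb; have [] := Pp j.
  move=> /(psumr_eq0P (fun j _ => pos j)) /(_ i isT) /eqP;
    rewrite mulf_eq0 (negPf wi) subr_eq0 /=.
  by move=> /eqP.
have [i wi] : exists i, w i != 0.
  apply/existsP; apply: contraPT w1; rewrite negb_exists => /forallP wN.
  rewrite big1 => [/esym/eqP|j _]; first by rewrite oner_eq0.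
  by have := wN j; rewrite negbK => /eqP.
(* Points of weight zero may lie off the face and are replaced by one that lies on it. *)
exists k, (fun j => if w j == 0 then p i else p j), w; split=> //.
  move=> j /=; apply/pointsP; rewrite FE; case: ifPn => [_|wj].
    by have [] := Pp i; split=> //; split=> //; apply: tight.
  by have [] := Pp j; split=> //; split=> //; apply: tight.
rewrite xp; apply: eq_bigr => j _; case: eqVneq => // ->.
by rewrite !scale0r.
Qed.

(* Tilt the supporting hyperplane of F along c until it meets a new point. *)
Lemma face_rotation P F v y c b : spanned P -> face P F -> P v -> ~ F v ->
  (forall x, F x -> dot c x = b) -> dot c v = b -> P y -> dot c y <> b ->
  exists F', [/\ face P F', F `<=` F', ~ F' v &
    exists u, [/\ u \in a, F' u & ~ F u]].
Proof.
move=> hP [d [f [df FE]]] Pv Fv cF cv Py cy.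
(* Up to the sign of [c], some point lies beyond [b]; otherwise [c] would be constant on [P],
   contrary to the choice of [y]. *)
wlog [u /pointsP[ua Pu] cu] : c b cF cv cy / exists2 u, u \in points P & b < dot c u.
  move=> wl; have [[u uP cu]|nogt] := pselect (exists2 u, u \in points P & b < dot c u).
    by apply: (wl c b) => //; exists u.
  have [[u uP cu]|nolt] := pselect (exists2 u, u \in points P & dot c u < b).
    apply: (wl (- c) (- b)) => [x /cF <-|||]; rewrite ?dotN ?cv //.
      by move=> /oppr_inj.
    by exists u; rewrite // dotN ltrN2.
  exfalso; apply: cy; move: Py; rewrite hP; apply: convex_hull_spans => u uP.
  apply/eqP; rewrite eq_le !leNgt; apply/andP.
  by split; apply/negP => ?; [apply: nogt|apply: nolt]; exists u.
(* The tilt at which the hyperplane passes through [x]; the least value gives the first contact. *)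
pose g x := (f - dot d x) / (dot c x - b).
have u_gt : u \in [seq x <- points P | b < dot c x].
  by rewrite mem_filter cu; apply/pointsP.
have [||u0] := @seq_least _ (fun x y => g x <= g y) _ u _ _ u_gt.
- by move=> x z; apply: le_total.
- by move=> x z w; apply: le_trans.
rewrite mem_filter => /andP[cu0 /pointsP[u0a Pu0]] min.
have Ple x : P x -> dot d x <= f by apply: df.
have g0 : 0 <= g u0 by rewrite divr_ge0 // subr_ge0 ?Ple // ltW.
have E x : dot (d + g u0 *: c) x = dot d x + g u0 * dot c x.
  by rewrite dotC linearD linearZ /= !(dotC x).
exists (P `&` [set x | dot (d + g u0 *: c) x = f + g u0 * b]); split.
- exists (d + g u0 *: c), (f + g u0 * b); split=> // x.
  rewrite {1}hP; apply: convex_hull_le => w wP; rewrite E.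
  have /pointsP[wa Pw] := wP; have [cw|cw] := leP (dot c w) b.
    by rewrite lerD ?Ple // ler_wpM2l.
  have := min w; rewrite mem_filter cw wP => /(_ isT) gw.
  have cwb : 0 < dot c w - b by rewrite subr_gt0.
  have : g u0 * (dot c w - b) <= f - dot d w.
    by rewrite -ler_pdivlMr.
  by lra.
- move=> x Fx /=; split; first by move: Fx; rewrite FE => -[].
  have dx : dot d x = f by move: Fx; rewrite FE => -[].
  by rewrite E cF // dx.
- move=> [_ /=]; rewrite E cv => /addIr dv; apply: Fv; rewrite FE; split=> //.
- exists u0; split=> //; last by move=> /cF cb; rewrite cb ltxx in cu0.
  split=> //=; rewrite E /g; field.
  by rewrite subr_eq0 gt_eqF.
Qed.

Definition cone_base F v : set vec := [set x | x = v \/ F x].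

(** A functional constant on [F] and [v] but not on [P] would allow a rotation to a face strictly
    between [F] and [P]. *)
Lemma facet_spans P F v : spanned P -> facet P F -> P v -> ~ F v ->
  affinely_spans (cone_base F v) P.
Proof.
move=> hP [faceF _ maxF] Pv Fv c b cb y Py; apply: contrapT => cy.
have [||F' [faceF' FF' F'v [u [_ F'u Fu]]]] :=
  face_rotation hP faceF Pv Fv _ _ Py cy; first by move=> x Fx; apply: cb; right.
  by apply: cb; left.
by have [F'E|F'E] := maxF F' faceF' FF'; [rewrite F'E in F'u|rewrite F'E in F'v].
Qed.

(** A larger face containing [v] has a functional constant on the spanning set, so it is [P]. If it
    misses [v], a combination of its functional with that of [F] is constant on the spanning set,
    hence on [P], which places the larger face inside [F]. *)
Lemma spans_facet P F v : face P F -> P v -> ~ F v ->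
  affinely_spans (cone_base F v) P -> facet P F.
Proof.
move=> faceF Pv Fv spans; split=> //; first by move=> FP; rewrite FP in Fv.
move=> F' [d' [f' [df' F'E]]] FF'; have [F'v|F'v] := pselect (F' v).
  right; apply/seteqP; split=> x; first by rewrite F'E => -[].
  move=> Px; rewrite F'E; split=> //; apply: (spans d' f') => // u [->|/FF'].
    by move: F'v; rewrite F'E => -[].
  by rewrite F'E => -[].
have [d [f [df FE]]] := faceF; left; apply/seteqP; split=> // x F'x.
have Px : P x by move: F'x; rewrite F'E => -[].
have d'x : dot d' x = f' by move: F'x; rewrite F'E => -[].
have E y : dot ((f - dot d v) *: d' - (f' - dot d' v) *: d) y =
    (f - dot d v) * dot d' y - (f' - dot d' v) * dot d y.
  by rewrite dotC linearB !linearZ /= !(dotC y).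
have H : dot ((f - dot d v) *: d' - (f' - dot d' v) *: d) x =
    (f - dot d v) * f' - (f' - dot d' v) * f.
  apply: spans Px => u [->|Fu]; rewrite E; first by ring.
  have -> : dot d u = f by move: Fu; rewrite FE => -[].
  by have -> : dot d' u = f' by move: (FF' u Fu); rewrite F'E => -[].
rewrite E d'x in H.
rewrite FE; split=> //=; apply/eqP; rewrite -/(dot d x) -subr_eq0.
have d'v : f' - dot d' v != 0.
  by rewrite subr_eq0; apply/eqP => d'v; apply: F'v; rewrite F'E.
have : (f' - dot d' v) * (dot d x - f) = 0 by lra.
by move=> /eqP; rewrite mulf_eq0 (negPf d'v).
Qed.

(** Start from the empty face and rotate, always avoiding [v], until the face and [v] span [P]. Each
    rotation gains a point of [a], and [k] bounds the rotations left. *)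
Lemma facet_exists P v : spanned P -> P v -> exists2 F, facet P F & ~ F v.
Proof.
move=> hP Pv.
suff grow k F : face P F -> ~ F v -> (size a <= size (points F) + k)%N ->
    exists2 F', facet P F' & ~ F' v.
  apply: (grow (size a) set0) => //; last by rewrite leq_addl.
  exists 0, 1; split=> [x _|]; first by rewrite -/(dot 0 x) dot0 ler01.
  apply/esym/seteqP; split=> // x [_ /=]; rewrite -/(dot 0 x) dot0 => /esym/eqP.
  by rewrite oner_eq0.
elim: k F => [|k IHk] F faceF Fv leF.
all: have [spans|] := pselect (affinely_spans (cone_base F v) P);
  first by exists F => //; apply: spans_facet faceF Pv Fv spans.
all: move=> /existsNP[c /existsNP[b /not_implyP[cb /existsNP[y /not_implyP[Py cy]]]]].
all: have [||F' [faceF' FF' F'v [u [ua F'u Fu]]]] :=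
  face_rotation hP faceF Pv Fv _ _ Py cy;
  [by move=> x Fx; apply: cb; right|by apply: cb; left|].
all: have ltF := size_points_lt FF' ua F'u Fu.
  have : (size (points F') <= size a)%N by rewrite size_filter count_size.
  by rewrite addn0 in leF; move=> /(leq_trans ltF) /(leq_ltn_trans leF); rewrite ltnn.
apply: (IHk F') => //; apply: leq_trans leF _.
by rewrite addnS -addSn leq_add2r.
Qed.

Lemma pulling_cellP P s : pulling_cell a P s -> spanned P ->
  [/\ affinely_independent s, forall v, v \in s -> v \in a /\ P v &
    affinely_spans [set` s] P].
Proof.
elim=> [|{}P F v {}s headv facetF Fv _ IHs] hP.
  by split=> // w _ _ v; rewrite in_fset0.
have /pointsP[va Pv] : v \in points P.
  by move: headv; rewrite /points; case: [seq _ <- _ | _] => //= u l [->]; exact: mem_head.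
have [faceF _ _] := facetF; have FP := face_subset faceF.
have [indep sF spans] := IHs (face_spanned hP faceF).
split.
- apply: separated_affinely_independent => u; rewrite in_fset1U.
  have [d [f [_ FE]]] := faceF.
  have dF x : F x -> dot d x = f by rewrite FE => -[].
  have dv : dot d v - f != 0.
    by rewrite subr_eq0; apply/eqP => dv; apply: Fv; rewrite FE.
  case: eqVneq => [->|uv /= us].
    exists d, f; split; first by rewrite -subr_eq0.
    move=> w; rewrite in_fset1U => /orP[->//|/sF[_ /dF]//].
  have [c [b [cu cw]]] := affinely_independent_dual indep us.
  (* Since [d] is constant on the facet, adding a multiple of it keeps [u] separated there; [k]
     makes the value at the apex [v] agree as well. *)
  pose k := (b - dot c v) / (dot d v - f).
  have E x : dot (c + k *: d) x = dot c x + k * dot d x.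
    by rewrite dotC linearD linearZ /= !(dotC x).
  exists (c + k *: d), (b + k * f); split.
    rewrite E dF; last by have [] := sF u us.
    by apply: contra_eqN cu => /eqP /addIr ->; rewrite subrr eq_sym oner_eq0.
  move=> w; rewrite in_fset1U => /orP[/eqP-> _|ws wu].
    by rewrite E /k; field.
  by rewrite E cw // dF //; have [] := sF w ws.
- by move=> u; rewrite in_fset1U => /orP[/eqP->//|/sF[ua /FP]].
- move=> c b cb; apply: (facet_spans hP facetF Pv Fv) => x [->|Fx].
    by apply: cb; rewrite /= fset1U1.
  by apply: (spans c b) => // u us; apply: cb; rewrite /= in_fset1U us orbT.
Qed.

Lemma pulling_cell_exists P : spanned P -> exists s, pulling_cell a P s.
Proof.
have [k] := ubnP (size (points P)); elim: k P => // k IHk P leP hP.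
case pP: (points P) => [|v l].
  exists fset0; rewrite (_ : P = set0); first exact: pulling_cell0.
  apply/seteqP; split=> // x; rewrite hP pP => /convex_hull_mono H.
  by apply: (@convex_hull0 R n x); apply: H => y.
have /pointsP[va Pv] : v \in points P by rewrite pP mem_head.
have [F facetF Fv] := facet_exists hP Pv; have [faceF _ _] := facetF.
have ltF := size_points_lt (face_subset faceF) va Pv Fv.
have [s cell] := IHk F (leq_trans ltF leP) (face_spanned hP faceF).
by exists (v |` s)%fset; apply: pulling_cell_cone cell => //; rewrite -/(points P) pP.
Qed.

Lemma maximal_pulling_cell P s :
  maximal_simplex (pulling_triangulation a P) s -> pulling_cell a P s.
Proof.
by move=> [[t cell_t st] maxs]; rewrite -(maxs t) //; exists t.
Qed.

Lemma pulling_cell_maximal P s : spanned P -> pulling_cell a P s ->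
  maximal_simplex (pulling_triangulation a P) s.
Proof.
move=> hP cell_s; split=> [|t [t' cell_t' tt'] st]; first by exists s.
have [_ _ spans] := pulling_cellP cell_s hP.
have [indep t'P _] := pulling_cellP cell_t' hP.
have t's := spanning_simplex_maximal spans indep (fun v vt => (t'P v vt).2)
  (fsubset_trans st tt').
by apply/eqP; rewrite eqEfsubset st andbT -t's.
Qed.

End Pulling.

(** * The lexicographic triangulation *)

Section Lexicographic.
Local Open Scope ring_scope.
Variables (R : realType) (T : eqType).
Implicit Types (L : seq T) (u w : T -> R).

(** The positive cone of the lexicographic order along [L]: the negation of [lexpos] for [w - w']
    says that [w] is at most [w']. *)
Fixpoint lexpos L u : bool :=
  if L is v :: L' then (0 < u v) || (u v == 0) && lexpos L' u else false.

Lemma lexpos_ext L u w : {in L, u =1 w} -> lexpos L u = lexpos L w.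
Proof.
elim: L => //= v L IHL uw; rewrite uw ?mem_head // IHL // => z zL.
by rewrite uw // in_cons zL orbT.
Qed.

Lemma lexposD L u w : lexpos L u -> lexpos L w -> lexpos L (fun v => u v + w v).
Proof.
elim: L => //= v L IHL; case/orP=> [u0|/andP[/eqP u0 uL]];
  case/orP=> [w0|/andP[/eqP w0 wL]]; rewrite ?u0 ?w0 ?addr0 ?add0r ?u0 ?w0 //.
  by rewrite addr_gt0.
by rewrite eqxx IHL // orbT.
Qed.

Lemma lexposZ L k u : 0 < k -> lexpos L (fun v => k * u v) = lexpos L u.
Proof. by move=> k0; elim: L => //= v L ->; rewrite pmulr_rgt0 // mulf_eq0 gt_eqF. Qed.

Lemma lexpos_gt0 L u : lexpos L u -> exists2 v, v \in L & 0 < u v.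
Proof.
elim: L => //= v L IHL /orP[u0|/andP[_ /IHL[z zL u0]]].
  by exists v; rewrite ?mem_head.
by exists z; rewrite // in_cons zL orbT.
Qed.

Lemma lexpos_opp L u : lexpos L u -> ~~ lexpos L (fun v => - u v).
Proof.
move=> uL; apply/negP => /(lexposD uL) /lexpos_gt0[v _].
by rewrite subrr ltxx.
Qed.

Lemma lexposNP L u :
  ~~ lexpos L u -> {in L, forall v, u v = 0} \/ lexpos L (fun v => - u v).
Proof.
elim: L => [_|v L IHL /=]; first by left.
rewrite negb_or negb_and oppr_gt0 oppr_eq0 -leNgt le_eqVlt.
case/andP=> /orP[/eqP u0|->]; last by right.
rewrite u0 eqxx ltxx /= => /IHL[uL|->]; last by right.
by left=> z; rewrite in_cons => /orP[/eqP->|/uL].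
Qed.

Lemma lexpos_cat L1 L2 u v : {in L1, forall z, 0 <= u z} -> v \in L1 -> u v != 0 ->
  lexpos (L1 ++ L2) u.
Proof.
elim: L1 => //= z L1 IHL u0; rewrite in_cons.
have := u0 z (mem_head _ _); rewrite le_eqVlt => /orP[/eqP uz|-> //].
case: eqVneq => [->|_ /= vL uv]; first by rewrite -uz eqxx.
rewrite -uz eqxx IHL ?orbT // => t tL.
by apply: u0; rewrite in_cons tL orbT.
Qed.

End Lexicographic.

(** * Lexicographically smallest convex representations *)

Section LexTriangulation.
Local Open Scope classical_set_scope.
Local Open Scope ring_scope.
Variables (R : realType) (n : nat).
Local Notation vec := 'rV[R]_n.
Variable L : seq vec.
Hypothesis uniqL : uniq L.
Implicit Types (s t : {fset vec}) (x v : vec) (u w : vec -> R).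

Definition balanced u := \sum_(v <- L) u v = 0 /\ \sum_(v <- L) u v *: v = 0.

Lemma balancedN u : balanced u -> balanced (fun v => - u v).
Proof.
move=> [u1 u2]; split; first by rewrite sumrN u1 oppr0.
by under eq_bigr do rewrite scaleNr; rewrite sumrN u2 oppr0.
Qed.

(* Here u is the difference of two convex representations of a point on L, the
   subtracted one being supported by s: the condition says that a representation on s
   is lexicographically smaller than any other representation of the same point. *)
Definition lex_simplex s := [set` s] `<=` [set` L] /\
  forall u, balanced u -> (forall v, v \in L -> v \notin s -> 0 <= u v) ->
    (exists2 v, v \in L & u v != 0) -> lexpos L u.

Definition feasible x w := [/\ forall v, v \in L -> 0 <= w v,
  \sum_(v <- L) w v = 1 & \sum_(v <- L) w v *: v = x].

Lemma feasible_add x w u : feasible x w -> balanced u ->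
  (forall v, v \in L -> 0 <= w v + u v) -> feasible x (fun v => w v + u v).
Proof.
move=> [w0 w1 wx] [u1 u2] wu; split=> //; first by rewrite big_split /= w1 u1 addr0.
by under eq_bigr do rewrite scalerDl; rewrite big_split /= wx u2 addr0.
Qed.

Lemma feasible_sub x w w' : feasible x w -> feasible x w' ->
  balanced (fun v => w v - w' v).
Proof.
move=> [_ w1 wx] [_ w1' wx']; split; first by rewrite sumrB w1 w1' subrr.
by under eq_bigr do rewrite scalerBl; rewrite sumrB wx wx' subrr.
Qed.

Definition support w : seq vec := [seq v <- L | w v != 0].

(** Basic solutions in the sense of linear programming: the support is affinely independent. *)
Definition basic w := forall u, balanced u ->
  (forall v, v \in L -> w v = 0 -> u v = 0) -> forall v, v \in L -> u v = 0.

(** A nonbasic [w] can be moved against a lexicographically positive direction within its support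
    until a weight becomes zero; this lowers [w] and shrinks the support. *)
Lemma basic_below x w : feasible x w ->
  exists w', [/\ feasible x w', basic w' & ~~ lexpos L (fun v => w' v - w v)].
Proof.
have [k] := ubnP (size (support w)); elim: k w => // k IHk w ltk fw.
have [bw|/existsNP[u /not_implyP[bu /not_implyP[uw /existsNP[v /not_implyP[vL uv]]]]]] :=
  pselect (basic w).
  exists w; split=> //; apply/negP => /lexpos_gt0[v _].
  by rewrite subrr ltxx.
wlog ul : u bu uw uv / lexpos L u.
  move=> wl; have [ul|/lexposNP[u0|ul]] := boolP (lexpos L u); first exact: (wl u).
    by case: uv; apply: u0.
  apply: (wl (fun v => - u v)) => //; first exact: balancedN.
    by move=> z zL /(uw z zL) ->; rewrite oppr0.
  by move=> /eqP; rewrite oppr_eq0 => /eqP.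
have [w0 _ _] := fw.
have [z0 z0L uz0] := lexpos_gt0 ul.
have := @seq_least _ (fun y z => w y / u y <= w z / u z) [seq z <- L | 0 < u z] z0.
case=> [y z|y z t| |z]; [exact: le_total|exact: le_trans|by rewrite mem_filter uz0|].
rewrite mem_filter => /andP[uz zL] min.
(* Ratio test: the largest step that keeps all weights nonnegative. *)
pose k0 := w z / u z.
have k0_gt0 : 0 < k0.
  rewrite divr_gt0 // lt_neqAle w0 // andbT eq_sym.
  by apply/eqP => /(uw z zL) uz_eq0; rewrite uz_eq0 ltxx in uz.
have fw' : feasible x (fun v => w v + - k0 * u v).
  apply: feasible_add => //.
    have [u1 u2] := bu; split; first by rewrite -mulr_sumr u1 mulr0.
    by under eq_bigr do rewrite -scalerA; rewrite -scaler_sumr u2 scaler0.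
  move=> y yL; have [uy|uy] := ltP 0 (u y).
    have := min y; rewrite mem_filter uy yL => /(_ isT).
    by rewrite -/k0 ler_pdivlMr // mulNr subr_ge0.
  by rewrite addr_ge0 ?w0 // mulNr oppr_ge0 pmulr_rle0.
have [|w'' [fw'' bw'' lew'']] := IHk _ _ fw'.
  rewrite ltnS in ltk; apply: leq_trans _ ltk.
  have zw : z \in support w.
    rewrite mem_filter zL andbT; apply/eqP => /(uw z zL) uz_eq0.
    by rewrite uz_eq0 ltxx in uz.
  rewrite [X in (_ < X)%N](perm_size (perm_to_rem zw)) /= ltnS.
  apply: uniq_leq_size; first exact: filter_uniq.
  move=> y; rewrite mem_filter => /andP[w'y yL].
  rewrite mem_rem_uniq ?filter_uniq // inE mem_filter yL andbT.
  apply/andP; split.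
    by apply: contraNneq w'y => ->; rewrite mulNr mulfVK ?subrr // gt_eqF.
  by apply: contraNneq w'y => wy; rewrite wy (uw y yL wy) mulr0 addr0.
exists w''; split=> //; apply: contraNN lew'' => lew.
have := lexposD lew (_ : lexpos L (fun v => k0 * u v)).
rewrite lexposZ // => /(_ ul); congr is_true; apply: lexpos_ext => y _.
by ring.
Qed.

Lemma lexpos_le_trans w1 w2 w3 : ~~ lexpos L (fun v => w1 v - w2 v) ->
  ~~ lexpos L (fun v => w2 v - w3 v) -> ~~ lexpos L (fun v => w1 v - w3 v).
Proof.
move=> /lexposNP[w12|w12] w23; apply: contraNN w23 => w13.
  rewrite (lexpos_ext (w := fun v => w1 v - w3 v)) // => v vL.
  by have := w12 v vL; lra.
have := lexposD w12 w13; congr is_true; apply: lexpos_ext => v _.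
by ring.
Qed.

(** A basic representation is determined by its support, so there are finitely many. The smallest of
    them is below every representation, because some basic one is. *)
Lemma lex_minimum x w : feasible x w ->
  exists2 w0, feasible x w0 &
    forall w', feasible x w' -> ~~ lexpos L (fun v => w0 v - w' v).
Proof.
move=> fw; pose good S w := [/\ feasible x w, basic w & support w = S].
have /choice[W WP] : forall S, exists w, (exists w', good S w') -> good S w.
  by move=> S; have [[w' gw']|] := pselect (exists w', good S w'); [exists w'|exists w].
pose supports := [seq S <- [seq mask m L | m : (size L).-tuple bool] |
  `[< exists w', good S w' >]].
have in_supports w' : feasible x w' -> basic w' -> support w' \in supports.
  move=> fw' bw'; rewrite mem_filter; apply/andP; split.
    by apply/asboolP; exists w'.
  apply/mapP; exists [tuple of map (fun v => w' v != 0) (in_tuple L)].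
    by rewrite mem_enum.
  by rewrite /= -filter_mask.
have good_eq S w1 w2 : good S w1 -> good S w2 -> {in L, w1 =1 w2}.
  move=> [f1 b1 s1] [f2 b2 s2] v vL; apply/eqP; rewrite -subr_eq0; apply/eqP.
  apply: (b1 (fun v => w1 v - w2 v)) => // [|z zL w1z]; first exact: feasible_sub f1 f2.
  have : z \notin support w2 by rewrite s2 -s1 mem_filter w1z eqxx.
  by rewrite mem_filter zL andbT negbK w1z sub0r => /eqP ->; rewrite oppr0.
have [w1 [fw1 bw1 _]] := basic_below fw.
have [||S] := @seq_least _ (fun S S' => ~~ lexpos L (fun v => W S v - W S' v))
    _ _ _ _ (in_supports w1 fw1 bw1).
- move=> S S'; rewrite -negb_and; apply/negP => /andP[/lexpos_opp + SS'].
  by apply/negP/negPn; congr is_true: SS'; apply: lexpos_ext => v _; ring.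
- by move=> S1 S2 S3; apply: lexpos_le_trans.
rewrite mem_filter => /andP[/asboolP gS _] min.
have [fS _ _] := WP S gS; exists (W S) => // w' fw'.
have [w2 [fw2 bw2 le2]] := basic_below fw'.
apply: lexpos_le_trans le2; have g2 : good (support w2) w2 by [].
rewrite (lexpos_ext (w := fun v => W S v - W (support w2) v)) ?min ?in_supports //.
move=> v vL; congr (_ - _); apply: (good_eq _ _ _ g2 _ v vL); apply: WP.
by exists w2.
Qed.

Lemma sum_restrict (V : lmodType R) (f : vec -> V) s w : {subset s <= L} ->
  (forall v, v \in L -> v \notin s -> w v = 0) ->
  \sum_(v <- L) w v *: f v = \sum_(v <- s) w v *: f v.
Proof.
move=> sL ws; rewrite (bigID (mem s)) /= [X in _ + X]big1_seq ?addr0; last first.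
  by move=> v /andP[vs vL]; rewrite ws // scale0r.
rewrite -big_filter; apply: perm_big.
apply: uniq_perm; rewrite ?filter_uniq ?fset_uniq // => v.
by rewrite mem_filter /=; apply/andP/idP => [[]//|vs]; split=> //; apply: sL.
Qed.

Lemma sum_restrict1 s w : {subset s <= L} ->
  (forall v, v \in L -> v \notin s -> w v = 0) ->
  \sum_(v <- L) w v = \sum_(v <- s) w v.
Proof.
move=> sL ws; have := @sum_restrict R^o (fun=> 1) s w sL ws.
by under eq_bigr do rewrite /GRing.scale /= mulr1;
   under [in X in _ = X -> _]eq_bigr do rewrite /GRing.scale /= mulr1.
Qed.

Definition extend s w v := if v \in s then w v else 0.

Lemma sum_extend s w : {subset s <= L} ->
  \sum_(v <- L) extend s w v = \sum_(v <- s) w v /\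
  \sum_(v <- L) extend s w v *: v = \sum_(v <- s) w v *: v.
Proof.
move=> sL.
have off v : v \in L -> v \notin s -> extend s w v = 0.
  by rewrite /extend => _ /negPf ->.
rewrite (sum_restrict1 sL off) (sum_restrict idfun sL off).
by split; apply: eq_big_seq => v vs; rewrite /extend vs.
Qed.

(** An affine dependency on [s] and its opposite would both be lexicographically positive. *)
Lemma lex_simplex_independent s : lex_simplex s -> affinely_independent s.
Proof.
move=> [sL lex_s] w w1 w2 v vs; apply/eqP/negPn/negP => wv.
pose u := extend s w; have bu : balanced u.
  by have [e1 e2] := sum_extend w sL; split; rewrite ?e1 ?e2.
have off z : z \in L -> z \notin s -> u z = 0.
  by rewrite /u /extend => _ /negPf ->.
have uv : u v != 0 by rewrite /u /extend vs.
have ul : lexpos L u.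
  apply: lex_s => // [z zL zs|]; first by rewrite off.
  by exists v => //; apply: sL.
have /negP := lexpos_opp ul; apply; apply: lex_s; first exact: balancedN.
  by move=> z zL zs; rewrite off // oppr0.
by exists v; rewrite ?oppr_eq0 //; apply: sL.
Qed.

Lemma lex_simplex_weights s x : lex_simplex s -> convex_hull [set` s] x ->
  exists2 w, feasible x w & forall v, v \notin s -> w v = 0.
Proof.
move=> [sL _] /convex_hull_seq[|w [w0 w1 ->]]; first exact: fset_uniq.
exists (extend s w); last by move=> v /negPf vs; rewrite /extend vs.
have [e1 e2] := sum_extend w sL; split; rewrite ?e1 //.
by move=> v _; rewrite /extend; case: ifP => // /w0.
Qed.

Lemma feasible_convex_hull s x w : {subset s <= L} -> feasible x w ->
  (forall v, v \in L -> v \notin s -> w v = 0) -> convex_hull [set` s] x.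
Proof.
move=> sL [w0 w1 wx] off; apply/convex_hull_seq; first exact: fset_uniq.
exists w; split; first by move=> v /sL /w0.
  by rewrite -w1 (sum_restrict1 sL off).
by rewrite -wx (sum_restrict idfun sL off).
Qed.

Lemma small_perturbation (K : seq vec) w u : (forall v, v \in K -> 0 < w v) ->
  exists2 k, 0 < k & forall v, v \in K -> 0 <= w v + k * u v.
Proof.
elim: K => [|v K IHK] w0; first by exists 1.
have [|k k0 kK] := IHK; first by move=> z zK; apply: w0; rewrite in_cons zK orbT.
have wv := w0 v (mem_head _ _); have d0 : 0 < `|u v| + 1 by rewrite ltr_wpDl.
have k'0 : 0 < w v / (`|u v| + 1) by rewrite divr_gt0.
exists (Num.min k (w v / (`|u v| + 1))); first by rewrite lt_min k0.
move=> z; rewrite in_cons => /orP[/eqP->|zK].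
  set m := Num.min _ _; have m0 : 0 < m by rewrite lt_min k0.
  have : m * (`|u v| + 1) <= w v by rewrite -ler_pdivlMr // ge_min lexx orbT.
  by have := ler_norm (- u v); rewrite normrN; nra.
set m := Num.min _ _; have m0 : 0 < m by rewrite lt_min k0.
have mk : m <= k by rewrite ge_min lexx.
have wz : 0 < w z by apply: w0; rewrite in_cons zK orbT.
by have := kK z zK; have [uz|uz] := leP 0 (u z); nra.
Qed.

Lemma lex_triangulation P : convex_hull [set` L] = P -> [set` L] `<=` lattice_points P ->
  triangulation P lex_simplex.
Proof.
move=> LP latL; split.
- apply: (@sub_finite_set _ _ [set` fpowerset [fset v | v in L]%fset]).
    move=> s [sL _] /=; rewrite fpowersetE; apply/fsubsetP => v vs.
    by rewrite !inE; apply: sL.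
  exact: finite_fset.
- move=> s lex_s; split; first exact: lex_simplex_independent.
  by have [sL _] := lex_s => v /sL /latL.
- move=> s t [sL lex_s] ts; split=> [v vt|u bu ut]; first exact/sL/(fsubsetP ts).
  apply: lex_s => // v vL vs; apply: ut => //; apply: contraNN vs.
  exact: (fsubsetP ts).
- move=> s t lex_s lex_t; apply/seteqP; split=> x; last first.
    move=> stx; split; apply: convex_hull_mono stx => v /=;
      by rewrite in_fsetI => /andP[].
  move=> [/(lex_simplex_weights lex_s)[w fw ws] /(lex_simplex_weights lex_t)[u fu ut]].
  (* If they differed, each of the two representations would be strictly smaller than the other. *)
  have wu : {in L, w =1 u}.
    move=> v vL; apply/eqP; rewrite -subr_eq0; apply/negPn/negP => wuv.
    have [w0 _ _] := fw; have [u0 _ _] := fu.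
    have [sL lex_s'] := lex_s; have [tL lex_t'] := lex_t.
    have := lexposD (lex_t' _ (feasible_sub fw fu) _ _) (lex_s' _ (feasible_sub fu fw) _ _).
    move=> /(_ _ _ _ _)/lexpos_gt0[||||z _].
    + by move=> z zL zt; rewrite ut // subr0 w0.
    + by exists v.
    + by move=> z zL zs; rewrite ws // subr0 u0.
    + by exists v => //; rewrite -oppr_eq0 opprB.
    by rewrite addrA subrK subrr ltxx.
  have [sL _] := lex_s; apply: (feasible_convex_hull (w := w)) => // v.
    by rewrite in_fsetI => /andP[/sL].
  move=> vL; rewrite in_fsetI negb_and => /orP[/ws//|/ut].
  by rewrite wu.
- apply/seteqP; split=> [x [s [sL _]]|x].
    by rewrite -LP; apply: convex_hull_mono.
  rewrite -LP => /(convex_hull_seq _ uniqL)[w [w0 w1 wx]].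
  have [w' fw' minw'] := @lex_minimum x w (And3 w0 w1 (esym wx)).
  pose s := [fset v | v in support w']%fset.
  have sP v : (v \in s) = (v \in L) && (w' v != 0) by rewrite !inE mem_filter andbC.
  have sL : {subset s <= L} by move=> v; rewrite sP => /andP[].
  have off v : v \in L -> v \notin s -> w' v = 0.
    by move=> vL; rewrite sP vL negbK => /eqP.
  exists s; last exact: feasible_convex_hull fw' off.
  split=> // u bu us [v vL uv]; have [w'0 _ _] := fw'.
  (* Adding a small multiple of [u] keeps the weights feasible, so minimality of [w'] makes [u]
     lexicographically positive. *)
  have [|k k0 kw'] := @small_perturbation (support w') w' u.
    by move=> z; rewrite mem_filter => /andP[w'z zL]; rewrite lt_neqAle eq_sym w'z w'0.
  have fk : feasible x (fun v => w' v + k * u v).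
    apply: (feasible_add (u := fun v => k * u v)) => // [|z zL].
      have [u1 u2] := bu; split; first by rewrite -mulr_sumr u1 mulr0.
      by under eq_bigr do rewrite -scalerA; rewrite -scaler_sumr u2 scaler0.
    have [zs|zs] := boolP (z \in s).
      by apply: kw'; move: zs; rewrite !inE.
    by rewrite addr_ge0 ?w'0 // mulr_ge0 ?us // ltW.
  have [/(_ v vL)/eqP|] := lexposNP (minw' _ fk).
    by rewrite opprD addNKr oppr_eq0 mulf_eq0 gt_eqF //= (negPf uv).
  rewrite -(lexposZ L u k0); congr is_true; apply: lexpos_ext => z _.
  by ring.
Qed.

(** Listing the vertices of [s] last forces it into the triangulation: the entries before them are
    nonnegative, and if these all vanish, [u] is a dependency on [s]. *)
Lemma lex_simplex_suffix L1 s : L = L1 ++ s -> affinely_independent s -> lex_simplex s.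
Proof.
move=> LE indep; have sL : {subset s <= L} by move=> v vs; rewrite LE mem_cat vs orbT.
split=> // u [u1 u2] u0 [v vL uv].
have [/hasP[z zL1 uz]|/hasPn uL1] := boolP (has (fun z => u z != 0) L1).
  rewrite LE; apply: lexpos_cat zL1 uz => t tL1; apply: u0.
    by rewrite LE mem_cat tL1.
  move: uniqL; rewrite LE cat_uniq => /and3P[_ /hasPn H _].
  by apply: contraTN tL1 => /H.
have off z : z \in L -> z \notin s -> u z = 0.
  rewrite LE mem_cat => /orP[zL1 _|->//]; apply/eqP.
  by rewrite -[_ == _]negbK; apply: uL1.
case/negP: uv; apply/eqP; have [vs|vs] := boolP (v \in s); last exact: off.
apply: (indep u) => //; first by rewrite -(sum_restrict1 sL off).
by rewrite -(sum_restrict idfun sL off).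
Qed.

End LexTriangulation.

(** * The simplex of an odd circuit *)

Section Proposition.
Local Open Scope classical_set_scope.
Local Open Scope ring_scope.
Variables (R : realType) (n : nat) (e : rel 'I_n).
Hypothesis e_sym : symmetric e.
Local Notation vec := 'rV[R]_n.
Local Notation Q := (stable_set_polytope R e).
Local Notation ind := (@indicator_vector R n).
Implicit Types (s t : {fset vec}) (c x v : vec) (W : {set 'I_n}) (a : seq vec).

Lemma lattice_points_spanned a : [set` a] = lattice_points Q -> spanned a Q.
Proof.
move=> aE; apply/seteqP; split=> x; apply: convex_hull_mono => v.
  move=> [W sW <-]; apply/pointsP.
  suff : [set` a] (ind W) by split=> //; apply: polytope_indicator.
  by rewrite aE lattice_pointsE; exists W.
move=> /pointsP[va _]; have : [set` a] v by [].
by rewrite aE lattice_pointsE => -[W sW ->]; exists W.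
Qed.

Lemma cobipartite_unimodular :
  bipartite (complement_graph e) -> unimodular_polytope Q.
Proof.
move=> [h bip] D triD s maxs.
have spans : affinely_spans [set` s] Q.
  apply: triangulation_maximal_spans triD maxs.
    by move=> x y k; apply: convex_hull_convex.
  by exists (ind finset.set0); apply/polytope_indicator/stable0.
have [_ /(_ _ maxs.1)[indep lat] _ _ _] := triD.
exact: (cobipartite_unimodular_simplex bip).
Qed.

Lemma cobipartite_compressed :
  bipartite (complement_graph e) -> compressed_polytope Q.
Proof.
move=> [h bip] a _ aE s /maximal_pulling_cell cell_s.
have [indep sQ spans] := pulling_cellP cell_s (lattice_points_spanned aE).
apply: (cobipartite_unimodular_simplex bip) => // v /sQ[va _].
by rewrite -aE.
Qed.

Definition stable_points : seq vec := [seq ind W | W <- enum [set W | stable e W]%SET].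

Lemma stable_pointsE : [set` stable_points] = lattice_points Q.
Proof.
rewrite lattice_pointsE; apply/seteqP; split=> v /=.
  by move=> /mapP[W]; rewrite mem_enum inE => sW ->; exists W.
by move=> [W sW ->]; apply: map_f; rewrite mem_enum inE.
Qed.

Lemma stable_points_uniq : uniq stable_points.
Proof. by rewrite map_inj_uniq ?enum_uniq //; apply: indicator_inj. Qed.

Section OddCircuit.
Variable F : {set 'I_n * 'I_n}.
Hypotheses (circF : odd_circuit F)
  (edgeF : forall p, p \in F -> complement_graph e p.1 p.2).
Local Notation S := (covered F).

Let loopless p : p \in F -> p.1 != p.2.
Proof. by move=> /edgeF /andP[]. Qed.

Let coveredF p : p \in F -> (p.1 \in S) && (p.2 \in S).
Proof.
by move=> pF; apply/andP; split; apply/coveredP; exists p; rewrite ?eqxx ?orbT.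
Qed.

Definition circuit_sum : vec := \row_j (j \in S)%:R.

Lemma dot_edge c p : p \in F -> dot c (ind [set p.1; p.2]%SET) = c 0 p.1 + c 0 p.2.
Proof. by move=> pF; rewrite dot_indicator big_setU1 ?big_set1 // inE loopless. Qed.

Lemma dot_vertex c j : dot c (ind [set j]%SET) = c 0 j.
Proof. by rewrite dot_indicator big_set1. Qed.

Lemma dot_origin c : dot c (ind finset.set0) = 0.
Proof. by rewrite dot_indicator big_set0. Qed.

Lemma edge_stable p : p \in F -> stable e [set p.1; p.2]%SET.
Proof. by move=> /edgeF; apply: stable2. Qed.

(* Every vertex of s has even coordinate sum over the circuit, so the affine lattice
   spanned by s misses the unit vectors of the circuit. *)
Lemma circuit_not_unimodular s :
  (forall v, v \in s -> dot circuit_sum v = 0 \/ dot circuit_sum v = 2) ->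
  ~ unimodular_simplex Q s.
Proof.
move=> even [_ _ sP].
have [p pF] : exists p, p \in F.
  apply/existsP; apply: contraT; rewrite negb_exists => /forallP F0; exfalso.
  apply: (odd_circuit_not_bipartite (f := fun=> true) circF) => p pF.
  by have := F0 p; rewrite pF.
have /andP[p1 _] := coveredF pF.
have [|w [_ xw]] := sP (ind [set p.1]%SET).
  by rewrite lattice_pointsE; exists [set p.1]%SET => //; apply: stable1.
have : dot circuit_sum (ind [set p.1]%SET) = 1 by rewrite dot_vertex mxE p1.
pose k v : int := if dot circuit_sum v == 0 then 0 else w v.
rewrite xw linear_sum /= (_ : \sum_(v <- s) _ = (2 * \sum_(v <- s) k v)%:~R).
  by move=> /(@intr_inj R _ 1); move: (\sum_(v <- s) k v) => m; lia.
rewrite mulr_sumr rmorph_sum /=; apply: eq_big_seq => v /even.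
rewrite raddfMz -mulrzr rmorphM /= /k => -[] ->; first by rewrite eqxx mul0r mulr0.
by rewrite pnatr_eq0.
Qed.

(** The origin gives [b = 0], and the edges make [c] vanish on the circuit. Outside it the product
    vanishes through [c] on the whole polytope and through [x] on a coordinate face. *)
Lemma circuit_spans (A P : set vec) c b :
  A (ind finset.set0) -> (forall p, p \in F -> A (ind [set p.1; p.2]%SET)) ->
  (forall x, P x -> forall j, j \notin S -> c 0 j * x 0 j = 0) ->
  (forall v, A v -> dot c v = b) -> forall x, P x -> dot c x = b.
Proof.
move=> A0 AF cP cA x Px; rewrite -(cA _ A0) dot_origin /dot big1 // => j _.
have b0 : b = 0 by rewrite -(cA _ A0) dot_origin.
have [jS|] := boolP (j \in S); last exact: cP.
rewrite (odd_circuit_kernel (c := c 0) circF) ?mul0r // => p pF.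
by rewrite -dot_edge // (cA _ (AF p pF)).
Qed.

Definition circuit_points : seq vec := ind finset.set0 ::
  [seq ind [set j]%SET | j <- enum (~: S)%SET] ++
  [seq ind [set p.1; p.2]%SET | p <- enum F].

Definition circuit_simplex := [fset v | v in circuit_points]%fset.

Lemma circuit_simplexP v : v \in circuit_simplex <->
  [\/ v = ind finset.set0, exists2 j, j \notin S & v = ind [set j]%SET |
      exists2 p, p \in F & v = ind [set p.1; p.2]%SET].
Proof.
have in_seq (l : seq vec) : (v \in [fset u | u in l]%fset) = (v \in l) by rewrite !inE.
rewrite in_seq in_cons mem_cat; split.
  case/or3P=> [/eqP->|/mapP[j]|/mapP[p]]; first by constructor 1.
    by rewrite mem_enum inE => jS ->; constructor 2; exists j.
  by rewrite mem_enum => pF ->; constructor 3; exists p.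
case=> [->|[j jS ->]|[p pF ->]]; first by rewrite eqxx.
  by apply/or3P; constructor 2; apply: map_f; rewrite mem_enum inE.
by apply/or3P; constructor 3; apply: map_f; rewrite mem_enum.
Qed.

Lemma circuit_simplex_independent : affinely_independent circuit_simplex.
Proof.
have S1 p : p \in F -> p.1 \in S by move=> /coveredF /andP[].
have S2 p : p \in F -> p.2 \in S by move=> /coveredF /andP[].
apply: separated_affinely_independent => v.
case/circuit_simplexP=> [->|[j jS ->]|[p pF ->]].
(* This functional is 1 on all vertices except the origin. *)
- exists (\row_i if i \in S then 2^-1 else 1), 1; split.
    by rewrite dot_origin eq_sym oner_eq0.
  move=> u /circuit_simplexP[->|[j jS ->]|[p pF ->]]; first by rewrite eqxx.
    by rewrite dot_vertex mxE (negPf jS).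
  by rewrite dot_edge // !mxE S1 // S2 // => _; lra.
- exists (delta_mx 0 j), 0; split; first by rewrite dot_vertex mxE !eqxx oner_eq0.
  move=> u /circuit_simplexP[->|[i iS ->] ij|[p pF ->] _]; first by rewrite dot_origin.
    rewrite dot_vertex mxE; have [ji|//] := eqVneq i j.
    by rewrite ji eqxx in ij.
  rewrite dot_edge // !mxE /=.
  have -> : (p.1 == j) = false by apply: contraNF jS => /eqP <-; apply: S1.
  have -> : (p.2 == j) = false by apply: contraNF jS => /eqP <-; apply: S2.
  by rewrite addr0.
(* The signs of a colouring of [F] minus [p] cancel on every edge except [p]. *)
- have [f [fp fq]] := odd_circuit_coloring circF pF.
  exists (\row_i if i \in S then (if f i then 1 else -1) else 0), 0; split.
    rewrite dot_edge // !mxE S1 // S2 // fp.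
    by case: (f _); apply/eqP; lra.
  move=> u /circuit_simplexP[->|[i iS ->]|[q qF ->] qp]; first by rewrite dot_origin.
    by rewrite dot_vertex mxE (negPf iS).
  have /(fq q qF) : q != p by apply: contraNneq qp => ->.
  rewrite dot_edge // !mxE S1 // S2 //.
  by case: (f q.1); case: (f q.2) => // _; rewrite ?subrr ?addNr.
Qed.

Lemma circuit_simplex_spans : affinely_spans [set` circuit_simplex] Q.
Proof.
move=> c b cb; apply: (circuit_spans (A := [set` circuit_simplex])) => //=.
- by apply/circuit_simplexP; constructor 1.
- by move=> p pF; apply/circuit_simplexP; constructor 3; exists p.
move=> x _ j jS; have <- : dot c (ind [set j]%SET) = c 0 j by rewrite dot_vertex.
rewrite cb; last by apply/circuit_simplexP; constructor 2; exists j.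
rewrite -(cb (ind finset.set0)) ?dot_origin ?mul0r //.
by apply/circuit_simplexP; constructor 1.
Qed.

Lemma dot_circuit_edge p : p \in F -> dot circuit_sum (ind [set p.1; p.2]%SET) = 2.
Proof. by move=> pF; rewrite dot_edge // !mxE; have /andP[-> ->] := coveredF pF. Qed.

Lemma dot_circuit_vertex j : j \notin S -> dot circuit_sum (ind [set j]%SET) = 0.
Proof. by move=> /negPf jS; rewrite dot_vertex mxE jS. Qed.

Lemma odd_circuit_not_unimodular : ~ unimodular_polytope Q.
Proof.
(* The circuit simplex comes last in the order, so it belongs to the lexicographic triangulation. *)
move=> uni; pose L := [seq v <- stable_points | v \notin circuit_simplex] ++ circuit_simplex.
have sL v : v \in circuit_simplex -> v \in stable_points.
  case/circuit_simplexP=> [->|[j jS ->]|[p pF ->]]; apply: map_f; rewrite mem_enum inE.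
  - exact: stable0.
  - exact: stable1.
  - exact: edge_stable.
have LE : [set` L] = lattice_points Q.
  rewrite -stable_pointsE; apply/seteqP; split=> v /=; rewrite mem_cat mem_filter.
    by case/orP=> [/andP[]//|/sL].
  by move=> ->; rewrite andbT; case: (v \in circuit_simplex).
have uL : uniq L.
  rewrite cat_uniq filter_uniq ?stable_points_uniq // fset_uniq andbT /=.
  by apply/hasPn => v vs; rewrite mem_filter vs.
have LQ : convex_hull [set` L] = Q.
  rewrite [RHS](lattice_points_spanned LE); congr convex_hull.
  apply/seteqP; split=> v /=; last by move/pointsP => [].
  move=> vL; apply/pointsP; split=> //.
  by have : [set` L] v by []; rewrite LE => -[].
have tri : triangulation Q (lex_simplex L).
  by apply: lex_triangulation => //; rewrite LE.
have lex_s := lex_simplex_suffix uL erefl circuit_simplex_independent.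
have maxs : maximal_simplex (lex_simplex L) circuit_simplex.
  split=> // t lex_t st; apply: spanning_simplex_maximal st.
  - exact: circuit_simplex_spans.
  - exact: (lex_simplex_independent uL).
  - by move=> v vt; have [tL _] := lex_t; move: (tL v vt); rewrite LE => -[].
apply: circuit_not_unimodular (uni _ tri _ maxs).
case=> [v] /circuit_simplexP[->|[j jS ->]|[p pF ->]].
- by left; rewrite dot_origin.
- by left; rewrite dot_circuit_vertex.
- by right; rewrite dot_circuit_edge.
Qed.

(** * A pulling triangulation that is not unimodular *)

Section Compressed.
Hypothesis e_le2 : (stability_number e <= 2)%N.
Local Notation J := (enum (~: S)%SET).

Definition pulling_head : seq vec :=
  [seq ind [set j]%SET | j <- J] ++ [:: ind finset.set0].

Definition pulling_order : seq vec :=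
  pulling_head ++ [seq v <- stable_points | v \notin pulling_head].

(** The face reached after pulling the unit vectors indexed by [K]. *)
Definition coordinate_face (K : seq 'I_n) : set vec :=
  Q `&` [set x | forall j, j \in K -> x 0 j = 0].

Lemma coordinate_face_indicator K W : stable e W ->
  (forall j, j \in K -> j \notin W) -> coordinate_face K (ind W).
Proof.
move=> sW KW; split; first exact: polytope_indicator.
by move=> j /KW /negPf jW; rewrite indicatorE jW.
Qed.

Lemma coordinate_face_rcons K j :
  face (coordinate_face K) (coordinate_face (rcons K j)).
Proof.
exists (- delta_mx 0 j), 0; split=> [x [Qx _]|].
  by rewrite -/(dot _ x) dotN dot_delta oppr_le0 (polytope_ge0 _ Qx).
apply/seteqP; split=> x; rewrite /= -/(dot _ x) dotN dot_delta.
  move=> [Qx xK]; split; last by rewrite xK ?oppr0 // mem_rcons mem_head.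
  by split=> // i iK; apply: xK; rewrite mem_rcons in_cons iK orbT.
move=> [[Qx xK] /eqP]; rewrite oppr_eq0 => /eqP xj; split=> // i.
by rewrite mem_rcons in_cons => /orP[/eqP->|/xK].
Qed.

Lemma pulling_orderE : [set` pulling_order] = lattice_points Q.
Proof.
rewrite -stable_pointsE; apply/seteqP; split=> v /=; rewrite mem_cat mem_filter.
  case/orP=> [|/andP[]//]; rewrite mem_cat => /orP[/mapP[j _ ->]|].
    by apply: map_f; rewrite mem_enum inE stable1.
  by rewrite inE => /eqP ->; apply: map_f; rewrite mem_enum inE stable0.
by move=> ->; rewrite andbT; case: (v \in pulling_head).
Qed.

Lemma pulling_order_uniq : uniq pulling_order.
Proof.
rewrite cat_uniq filter_uniq ?stable_points_uniq // andbT; apply/andP; split.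
  rewrite cat_uniq map_inj_uniq ?enum_uniq /=; last first.
    by move=> i j /indicator_inj /set1_inj.
  rewrite orbF andbT; apply/mapP => -[j _ /indicator_inj/setP/(_ j)].
  by rewrite !inE eqxx.
by apply/hasPn => v; rewrite mem_filter => /andP[].
Qed.

Lemma coordinate_face_nil : coordinate_face [::] = Q.
Proof. by apply/seteqP; split=> [x []|x Qx]. Qed.

Lemma coordinate_face_spanned K : spanned pulling_order (coordinate_face K).
Proof.
elim/last_ind: K => [|K j IHK]; last exact: face_spanned IHK (coordinate_face_rcons K j).
by rewrite coordinate_face_nil; apply/lattice_points_spanned/pulling_orderE.
Qed.

(** The unit vectors already pulled lie off the face, so its first point is found further along the
    order. *)
Lemma points_coordinate_face K r (l : seq vec) :
  points ([seq ind [set j]%SET | j <- K] ++ l) (coordinate_face (K ++ r)) =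
  points l (coordinate_face (K ++ r)).
Proof.
rewrite /points filter_cat -[RHS]cat0s; congr (_ ++ _).
apply/eqP; rewrite -(negbK (_ == _)) -has_filter; apply/hasPn => _ /mapP[j jK ->].
apply/negP => /set_mem[_ /(_ j)]; rewrite mem_cat jK => /(_ isT)/eqP.
by rewrite indicatorE inE eqxx oner_eq0.
Qed.

(** Going back through the prefixes of [J], each step cones from one unit vector outside the
    circuit, on which [circuit_sum] is 0. *)
Lemma pulling_cell_prefix K K' s : J = K ++ K' ->
  pulling_cell pulling_order (coordinate_face J) s ->
  exists2 s', pulling_cell pulling_order (coordinate_face K) s' &
    forall v, v \in s' -> v \in s \/ exists2 j, j \notin S & v = ind [set j]%SET.
Proof.
elim: K' K => [|j K' IHK'] K JE cell_s.
  by exists s; [move: cell_s; rewrite JE cats0|left].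
have [|s' cell_s' s's] := IHK' (rcons K j) _ cell_s; first by rewrite cat_rcons.
have jS : j \notin S by have := mem_enum (~: S)%SET j;
  rewrite JE mem_cat mem_head orbT inE => <-.
have jK : j \notin K.
  have := enum_uniq (~: S)%SET; rewrite JE cat_uniq => /and3P[_ /hasPn/(_ j)].
  by rewrite mem_head => /(_ isT).
have Kj : coordinate_face K (ind [set j]%SET).
  apply: coordinate_face_indicator; first exact: stable1.
  by move=> i iK; rewrite inE; apply: contraNneq jK => <-.
have nKj : ~ coordinate_face (rcons K j) (ind [set j]%SET).
  move=> [_ /(_ j)]; rewrite mem_rcons mem_head => /(_ isT)/eqP.
  by rewrite indicatorE inE eqxx oner_eq0.
exists (ind [set j]%SET |` s')%fset; last first.
  move=> v; rewrite in_fset1U => /orP[/eqP->|/s's//].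
  by right; exists j.
apply: pulling_cell_cone cell_s' => //.
  rewrite -/(points _ _) /pulling_order /pulling_head JE map_cat -!catA.
  have := points_coordinate_face K [::]; rewrite cats0 => ->.
  by rewrite /= /points /= mem_set.
(* The origin gives [b = 0], the unit vectors off [K] give [c 0 i = 0], and the coordinates in [K]
   vanish on the face. *)
apply: spans_facet (coordinate_face_rcons K j) Kj nKj _ => c b cb x [Qx xK].
have in_rcons W : stable e W -> (forall i, i \in rcons K j -> i \notin W) ->
    dot c (ind W) = b.
  by move=> sW KW; apply: cb; right; apply: coordinate_face_indicator.
have b0 : b = 0.
  rewrite -(in_rcons finset.set0) ?dot_origin ?stable0 // => i _.
  by rewrite inE.
rewrite b0 /dot big1 // => i _; have [iK|iK] := boolP (i \in K).
  by rewrite xK // mulr0.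
rewrite -[c 0 i]dot_vertex; have [->|ij] := eqVneq i j.
  by rewrite cb ?b0 ?mul0r //; left.
rewrite in_rcons ?b0 ?mul0r //; first exact: stable1.
move=> k; rewrite inE mem_rcons in_cons => /orP[/eqP->|kK].
  by rewrite eq_sym.
by apply: contraNneq iK => <-.
Qed.

Lemma odd_circuit_not_compressed : ~ compressed_polytope Q.
Proof.
move=> comp; pose P := coordinate_face J.
have JS j : (j \in J) = (j \notin S) by rewrite mem_enum inE.
have P0 : P (ind finset.set0).
  by apply: coordinate_face_indicator => [|j _]; rewrite ?stable0 ?inE.
pose G := P `&` [set x | dot circuit_sum x = 2].
(* Stable sets have at most two vertices, so [circuit_sum] is at most 2 on the polytope. *)
have faceG : face P G.
  exists circuit_sum, 2; split=> // x [Qx _]; apply: convex_hull_le Qx => _ [W sW <-].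
  rewrite -/(dot _ _) dot_indicator.
  apply: le_trans (_ : #|W|%:R <= _); last first.
    by rewrite ler_nat; apply: leq_trans e_le2; apply: leq_bigmax_cond.
  rewrite -sum1_card natr_sum; apply: ler_sum => j _.
  by rewrite mxE ler_nat leq_b1.
have G0 : ~ G (ind finset.set0).
  by move=> [_ /=]; rewrite dot_origin => /esym/eqP; rewrite pnatr_eq0.
have GF p : p \in F -> G (ind [set p.1; p.2]%SET).
  move=> pF; split; last exact: dot_circuit_edge.
  apply: coordinate_face_indicator => [|j]; first exact: edge_stable.
  rewrite JS; apply: contraNN; have /andP[p1 p2] := coveredF pF.
  by move=> /set2P[]->.
have facetG : facet P G.
  apply: spans_facet faceG P0 G0 _ => c b cb.
  apply: (circuit_spans (A := cone_base G (ind finset.set0))) => //.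
  - by left.
  - by move=> p pF; right; apply: GF.
  by move=> x [_ xJ] j; rewrite -JS => /xJ ->; rewrite mulr0.
(* Any cell of [G] will do, since [circuit_sum] is 2 on all its vertices. *)
have [t cell_t] := pulling_cell_exists (face_spanned (coordinate_face_spanned J) faceG).
have [_ tG _] := pulling_cellP cell_t (face_spanned (coordinate_face_spanned J) faceG).
have cell_P : pulling_cell pulling_order P (ind finset.set0 |` t)%fset.
  apply: pulling_cell_cone cell_t => //; rewrite -/(points _ _) /pulling_order.
  rewrite /pulling_head -catA.
  have := points_coordinate_face J [::]; rewrite cats0 => ->.
  by rewrite /= /points /= mem_set.
have [|s cell_s sP] := @pulling_cell_prefix [::] J _ _ cell_P; first by [].
rewrite coordinate_face_nil in cell_s.
have spQ : spanned pulling_order Q by rewrite -coordinate_face_nil;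
  exact: coordinate_face_spanned.
apply: circuit_not_unimodular
  (comp _ pulling_order_uniq pulling_orderE _ (pulling_cell_maximal spQ cell_s)).
move=> v /sP[|[j jS ->]]; last by left; rewrite dot_circuit_vertex.
rewrite in_fset1U => /orP[/eqP->|/tG[_ [_ vG]]]; last by right.
by left; rewrite dot_origin.
Qed.

End Compressed.
End OddCircuit.
End Proposition.

Theorem proposition1p8 (R : realType) (n : nat) (e : rel 'I_n)
    (e_sym : symmetric e) (e_irr : irreflexive e) :
  (unimodular_polytope (stable_set_polytope R e) <->
     bipartite (complement_graph e)) /\
  (stability_number e = 2 ->
     [<-> unimodular_polytope (stable_set_polytope R e);
          bipartite (complement_graph e);
          compressed_polytope (stable_set_polytope R e);
          perfect e]).
Proof.
have uni_bip : unimodular_polytope (stable_set_polytope R e) ->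
    bipartite (complement_graph e).
  move=> uni; have [//|[F circF edgeF]] := bipartite_or_odd_circuit (complement_graph e).
  by case: (odd_circuit_not_unimodular e_sym circF edgeF uni).
split; first by split=> //; apply: cobipartite_unimodular.
move=> e2; have e_le2 : stability_number e <= 2 by rewrite e2.
tfae.
- exact: uni_bip.
- exact: cobipartite_compressed.
- move=> comp; apply: cobipartite_perfect => //.
  have [//|[F circF edgeF]] := bipartite_or_odd_circuit (complement_graph e).
  by case: (odd_circuit_not_compressed e_sym circF edgeF e_le2 comp).
- move=> perf; apply: cobipartite_unimodular.
  exact: perfect_cobipartite e_le2 perf.
Qed.
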